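(* Let $K$ be an $R_1MF$-domain, let $\mathcal L$ be the variety of Lie algebras over $K$, and let $F=F(x_1,\dots,x_n)$ be a finitely generated free Lie algebra of $\mathcal L$, freely generated by $x_1,\dots,x_n$. Then every automorphism $\Phi$ of the semigroup $\mathrm{End}\,F$ is semi-inner, i.e. every element of the group $\mathrm{Aut}\,\mathrm{End}\,F$ is semi-inner.
   Context: All rings are commutative, associative, with $1$. A domain $K$ with quotient field $\tilde K$ is an $R_1MF$-domain if every $k\times l$ matrix over $K$ (any $k,l$) whose rank over $\tilde K$ equals $1$ is a product of a $k\times 1$ matrix over $K$ and a $1\times l$ matrix over $K$. $\mathrm{End}\,F$ is the semigroup (under composition) of $K$-algebra endomorphisms of $F$, and $\mathrm{Aut}\,\mathrm{End}\,F$ is the group of automorphisms of this semigroup. An automorphism $\Phi$ of $\mathrm{End}\,F$ is quasi-inner if there is a bijection $s:F\to F$ (called adjoint to $\Phi$) with $\Phi(\nu)=s\nu s^{-1}$ for all $\nu\in \mathrm{End}\,F$. A quasi-inner automorphism $\Phi$ is semi-inner if it has an adjoint bijection $s:F\to F$ and there is a ring automorphism $\varphi:K\to K$ such that for all $a,b\in F$, $\alpha\in K$: $s(a+b)=s(a)+s(b)$, $s(a\cdot b)=s(a)\cdot s(b)$ (here $\cdot$ is the multiplication of $F$, i.e. the Lie bracket), and $s(\alpha a)=\varphi(\alpha)s(a)$.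
   Formalization: The case n = 1 is excluded: there F = Kx₁ is abelian and End F is the multiplicative monoid of K, so for K = ℚ the automorphism swapping the primes 2 and 3 is not semi-inner. *)

(* Defs.v *)
From HB Require Import structures.
From mathcomp Require Import all_boot all_order all_algebra.
From mathcomp Require Import boolp.

Set Implicit Arguments.
Unset Strict Implicit.
Unset Printing Implicit Defensive.

Import GRing.Theory.
Local Open Scope ring_scope.

Definition R1MF (K : idomainType) : Prop :=
  forall (k l : nat) (A : 'M[K]_(k, l)),
    \rank (map_mx (@tofrac K) A) = 1%N ->
    exists (u : 'cV[K]_k) (v : 'rV[K]_l), A = u *m v.

(* Over a general base ring the bracket must be alternating, not just
   antisymmetric (the two differ in characteristic 2). *)
HB.mixin Record Lmodule_isLieAlgebra (K : comNzRingType) L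
    of GRing.Lmodule K L := {
  bracket : L -> L -> L;
  bracket_linearl : forall b : L, linear (bracket^~ b);
  bracket_linearr : forall a : L, linear (bracket a);
  bracketxx : forall a : L, bracket a a = 0;
  bracket_jacobi : forall a b c : L,
    bracket a (bracket b c) + bracket b (bracket c a) +
    bracket c (bracket a b) = 0
}.

#[short(type="lieAlgType")]
HB.structure Definition LieAlgebra (K : comNzRingType) :=
  {L of Lmodule_isLieAlgebra K L & GRing.Lmodule K L}.

HB.mixin Record isBracketMorphism (K : comNzRingType) (L M : lieAlgType K)
    (f : L -> M) := {
  bracket_morph : {morph f : a b / bracket a b >-> bracket a b}
}.

HB.structure Definition LieMorphism (K : comNzRingType)
    (L M : lieAlgType K) :=
  {f of isBracketMorphism K L M f & @GRing.Linear K L M *:%R f}.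

Notation "{ 'lie' L -> M }" := (LieMorphism.type L M)
  (at level 0, L at level 98, M at level 99,
   format "{ 'lie'  L  ->  M }") : type_scope.

Lemma lie_morphism_ext (K : comNzRingType) (L M : lieAlgType K)
  (f g : {lie L -> M}) : f =1 g -> f = g.
Proof.
case: f => f cf; case: g => g cg /= /funext efg; move: cf cg.
rewrite /= in efg; rewrite efg => -[a b c] -[a' b' c'].
case: a a' => a [a']; case: b b' => b [b']; case: c c' => c [c'].
by congr (LieMorphism.Pack (LieMorphism.Class _ _ _)); congr (_ _);
  apply: Prop_irrelevance.
Qed.

Section Composition.
Variables (K : comNzRingType) (L M N : lieAlgType K).
Variables (f : {lie M -> N}) (g : {lie L -> M}).

Lemma comp_bracket_morph :
  {morph (f \o g) : a b / bracket a b >-> bracket a b}.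
Proof. by move=> a b /=; rewrite !bracket_morph. Qed.

HB.instance Definition _ :=
  isBracketMorphism.Build K L N (f \o g) comp_bracket_morph.

Definition lie_comp : {lie L -> N} := f \o g.

End Composition.

Definition lie_end (K : comNzRingType) (F : lieAlgType K) : Type :=
  {lie F -> F}.

Section EndSemigroup.
Variables (K : comNzRingType) (F : lieAlgType K).

HB.instance Definition _ := gen_eqMixin (lie_end F).
HB.instance Definition _ := gen_choiceMixin (lie_end F).

Lemma lie_compA : associative (@lie_comp K F F F).
Proof. by move=> f g h; apply: lie_morphism_ext. Qed.

HB.instance Definition _ := isSemigroup.Build (lie_end F) lie_compA.

End EndSemigroup.

Definition freely_generates (K : comNzRingType) (F : lieAlgType K) (n : nat)
    (x : 'I_n -> F) : Prop :=
  forall (L : lieAlgType K) (y : 'I_n -> L),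
    exists! f : {lie F -> L}, forall i, f (x i) = y i.

Section SemiInner.
Variables (K : comNzRingType) (F : lieAlgType K).
Variable Phi : lie_end F -> lie_end F.

Definition adjoint_bijection (s : F -> F) : Prop :=
  exists t : F -> F, [/\ cancel s t, cancel t s &
    forall nu : {lie F -> F}, (Phi nu : {lie F -> F}) =1 s \o nu \o t].

Definition quasi_inner : Prop :=
  exists s : F -> F, adjoint_bijection s.

Definition semi_inner : Prop :=
  quasi_inner /\
  exists s : F -> F, adjoint_bijection s /\
    exists phi : {rmorphism K -> K}, bijective phi /\
      forall (a b : F) (alpha : K),
        [/\ s (a + b) = s a + s b,
            s (bracket a b) = bracket (s a) (s b) &
            s (alpha *: a) = phi alpha *: s a].

End SemiInner.

(* Main.v *)
Require Import Defs.
From HB Require Import structures.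
From mathcomp Require Import all_boot all_order all_algebra.
From mathcomp Require Import boolp ring.

Set Implicit Arguments.
Unset Strict Implicit.
Unset Printing Implicit Defensive.

Import GRing.Theory.
Local Open Scope ring_scope.

(** Write F for the free Lie algebra, x_i for its generators and n for their
    number. If n = 0 then F = 0, so let n >= 2.

    Step 1, an adjoint bijection. Let eps send every generator to one and the
    same x_i. The maps eps o nu o eps form a copy of the multiplicative monoid
    of K, so they commute and the only idempotents g with eps g = g eps = g are
    0 and eps. These properties pass to e = Phi(eps), called
    Phi_eps below. On F / [F, F] the
    commutation forces the matrix of e to have vanishing 2 x 2 minors, and that
    matrix is nonzero since an idempotent with values in [F, F] takes its values
    in every term of the lower central series, hence is zero. By the R1MF
    property the matrix of e is a product of a column and a row; this gives an
    idempotent onto a line K W fixed by e on both sides, so it is e itself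
    ([Phi_eps_rank_one]). Then s(a) = Phi(x_k |-> a)(W) is bijective and satisfies
    s(nu a) = Phi(nu)(s a) ([quasi_inner_adjoint]).

    Step 2, transporting the operations. For such an s with inverse t, each
    operation transported to F, such as t(s a + s b), commutes with all
    endomorphisms, so it is given by one Lie polynomial evaluated at (a, b).
    Three such polynomials have to be computed.
    - The scalar action t(c . s a) is psi(c) a, because a Lie polynomial in one
      variable is linear ([normalizes_scale]).
    - Addition: let w = t(s x_i + s x_j). As addition can be undone, some
      endomorphism x_i |-> w, x_j |-> psi(-1) x_j maps w to x_i. The chain rule
      for the noncommutative derivative with respect to x_i reads 1 = g d, where
      d is the derivative of w and g is another element of the free associative
      algebra. Units of that algebra are constants, so w is linear and
      w = x_i + x_j ([normalizes_add]). This works over every domain, finite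
      fields included, where homogeneity in the scalars gives too little.
    - The bracket: p = t[s x_i, s x_j] is alternating and biadditive. If three
      independent variables were at hand, biadditivity would give that the
      derivatives of p are linear forms, so p = c [x_i, x_j]. For n = 2 the
      elements x_i, [x_j, x_i], [x_j, [x_j, x_i]] play the role of three
      independent variables: in suitable 3 x 3 matrices their top rows can be
      prescribed at will ([realize3], [bilinear_alternating]).
    Hence s is additive, semilinear, and multiplicative up to a unit of K; a
    rescaling of s removes the unit.

    All computations with Lie polynomials take place in the free associative
    algebra, so they rest on the injectivity of the canonical map from F to
    noncommutative power series over an arbitrary commutative ring
    ([emb_inj]). It is proved with Lyndon words: the standard bracketings of
    Lyndon words span F, and the least word in the image of such a bracketing is
    the Lyndon word itself, with coefficient 1. *)

(** * Noncommutative power series and a Lie algebra of affine maps *)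

(** A series is its family of coefficients, indexed by words. Series rather than
    polynomials are used as the ring so that no support condition has to be
    carried along; finiteness of supports is a separate predicate, introduced
    for the statement on units. *)
Definition series (X : Type) (R : Type) : Type := seq X -> R.

Section SeriesModule.
Variables (K : comNzRingType) (X : Type) (R : algType K).
Implicit Types f g h : series X R.

HB.instance Definition _ := gen_eqMixin (series X R).
HB.instance Definition _ := gen_choiceMixin (series X R).

Fact series_addA :
  associative (fun f g : series X R => (fun w => f w + g w) : series X R).
Proof. by move=> f g h; apply/funext => w; rewrite addrA. Qed.
Fact series_addC :
  commutative (fun f g : series X R => (fun w => f w + g w) : series X R).
Proof. by move=> f g; apply/funext => w; rewrite addrC. Qed.
Fact series_add0 : left_id ((fun=> 0) : series X R)
  (fun f g : series X R => (fun w => f w + g w) : series X R).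
Proof. by move=> f; apply/funext => w; rewrite add0r. Qed.
Fact series_addN : left_inverse ((fun=> 0) : series X R)
  (fun f : series X R => (fun w => - f w) : series X R)
  (fun f g : series X R => (fun w => f w + g w) : series X R).
Proof. by move=> f; apply/funext => w; rewrite addNr. Qed.

HB.instance Definition _ := GRing.isZmodule.Build (series X R)
  series_addA series_addC series_add0 series_addN.

Lemma addsE f g w : (f + g) w = f w + g w. Proof. by []. Qed.
Lemma oppsE f w : (- f) w = - f w. Proof. by []. Qed.
Lemma zerosE w : (0 : series X R) w = 0. Proof. by []. Qed.

(** The Cauchy product. Peeling off the first letter, instead of summing over
    the cuts of the word, turns each ring axiom into an induction on words. *)
Fixpoint conv f g (w : seq X) : R :=
  if w is a :: w' then f [::] * g w + conv (fun v => f (a :: v)) g w'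
  else f [::] * g [::].

Definition lder (a : X) f : series X R := fun v => f (a :: v).
Definition rder (a : X) f : series X R := fun v => f (rcons v a).

Definition sone : series X R := fun w => if w is [::] then 1 else 0.

Fact conv0l g : conv (fun=> 0) g = fun=> 0.
Proof. by apply/funext; elim=> [|a w IH] /=; rewrite mul0r // add0r. Qed.
Fact convDl : left_distributive conv +%R.
Proof.
move=> f g h; apply/funext => w; elim: w f g => [|a w IH] f g /=.
  by rewrite mulrDl.
set fa : series X R := fun v => f (a :: v).
set ga : series X R := fun v => g (a :: v).
rewrite -[LHS]/((f [::] + g [::]) * h (a :: w) + conv (fa + ga) h w).
by rewrite IH mulrDl addrACA.
Qed.
Fact convDr : right_distributive conv +%R.
Proof.
move=> f g h; apply/funext => w; elim: w f => [|a w IH] f /=.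
  by rewrite mulrDr.
by rewrite IH mulrDr addrACA.
Qed.
Fact convZl c f g : conv (fun w => c * f w) g = fun w => c * conv f g w.
Proof.
apply/funext => w; elim: w f => [|a w IH] f /=; rewrite ?mulrA //.
by rewrite (IH (fun v => f (a :: v))) mulrDr mulrA.
Qed.
Fact convA : associative conv.
Proof.
move=> f g h; apply/funext => w; elim: w f => [|a w IH] f /=; rewrite ?mulrA //.
rewrite {}IH; set fa := fun v => f (a :: v).
have -> : (fun v => f [::] * g (a :: v) + conv fa g v) =
    ((fun v => f [::] * g (a :: v)) : series X R) + conv fa g by [].
by rewrite convDl addsE convZl mulrDr !mulrA addrA.
Qed.
Fact conv1l : left_id sone conv.
Proof.
by move=> f; apply/funext => -[|a w] /=; rewrite ?mul1r // conv0l addr0.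
Qed.
Fact conv1r : right_id sone conv.
Proof.
move=> f; apply/funext => w; elim: w f => [|a w IH] f /=; rewrite ?mulr1 //.
by rewrite mulr0 add0r IH.
Qed.
Fact sone_neq0 : sone != 0.
Proof.
by apply/eqP => /(congr1 (fun f : series X R => f [::])); apply/eqP/oner_neq0.
Qed.

HB.instance Definition _ := GRing.Zmodule_isNzRing.Build (series X R)
  convA conv1l conv1r convDl convDr sone_neq0.

Lemma muls_nil f g : (f * g) [::] = f [::] * g [::]. Proof. by []. Qed.
Lemma muls_cons f g a w : (f * g) (a :: w) =
  f [::] * g (a :: w) + (lder a f * g) w.
Proof. by []. Qed.
Lemma ones_E w : (1 : series X R) w = (nilp w)%:R. Proof. by case: w. Qed.

Definition sscale (c : K) f : series X R := fun w => c *: f w.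
Fact sscaleA a b f : sscale a (sscale b f) = sscale (a * b) f.
Proof. by apply/funext => w; rewrite /sscale scalerA. Qed.
Fact sscale1 : left_id 1 sscale.
Proof. by move=> f; apply/funext => w; rewrite /sscale scale1r. Qed.
Fact sscaleDr : right_distributive sscale +%R.
Proof. by move=> c f g; apply/funext => w; rewrite /sscale scalerDr. Qed.
Fact sscaleDl f : {morph sscale^~ f : a b / a + b}.
Proof. by move=> a b; apply/funext => w; rewrite /sscale scalerDl. Qed.

HB.instance Definition _ := GRing.Zmodule_isLmodule.Build K (series X R)
  sscaleA sscale1 sscaleDr sscaleDl.

Lemma scalesE c f w : (c *: f) w = c *: f w. Proof. by []. Qed.

Fact sscaleAl (c : K) f g : c *: (f * g) = c *: f * g.
Proof.
apply/funext => w; rewrite scalesE; elim: w f => [|a w IH] f.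
  by rewrite !muls_nil scalerAl.
by rewrite !muls_cons scalerDr IH scalerAl.
Qed.

HB.instance Definition _ :=
  GRing.Lmodule_isLalgebra.Build K (series X R) sscaleAl.

Fact sscaleAr (c : K) f g : c *: (f * g) = f * (c *: g).
Proof.
apply/funext => w; rewrite scalesE; elim: w f => [|a w IH] f.
  by rewrite !muls_nil scalerAr.
by rewrite !muls_cons scalerDr IH scalerAr.
Qed.

HB.instance Definition _ :=
  GRing.Lalgebra_isAlgebra.Build K (series X R) sscaleAr.

Lemma muls_rcons f g w a : (f * g) (rcons w a) =
  (f * rder a g) w + f (rcons w a) * g [::].
Proof.
elim: w f => [|b w IH] f /=; first by rewrite !muls_cons !muls_nil.
by rewrite !muls_cons IH; apply: addrA.
Qed.

(** Only one cut of a word contributes when the left factor is homogeneous. *)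
Lemma muls_homogl f g k w : (forall v, size v != k -> f v = 0) ->
  (f * g) w = if (k <= size w)%N then f (take k w) * g (drop k w) else 0.
Proof.
elim: w f k => [|a w IH] f k hf.
  by rewrite muls_nil; case: k hf => [//|k] ->; rewrite ?mul0r.
rewrite muls_cons; case: k hf => [|k] hf.
  have -> : lder a f = 0.
    by apply/funext => v; apply: hf.
  by rewrite mul0r zerosE addr0 take0 drop0.
by rewrite hf // mul0r add0r (IH _ k) //= => v hv; apply: hf.
Qed.

(** Lengths add up: the coefficient of a longest possible word comes from a
    single cut. This replaces a degree theory for the free associative algebra. *)
Lemma muls_top f g u v :
  (forall w, (size u < size w)%N -> f w = 0) ->
  (forall w, (size v < size w)%N -> g w = 0) ->
  (f * g) (u ++ v) = f u * g v.
Proof.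
elim: u f => [|a u IH] f hf hg /=.
  case: v hg => [|b v] hg; first by rewrite muls_nil.
  rewrite muls_cons.
  have -> : lder b f = 0.
    by apply/funext => w; apply: hf.
  by rewrite mul0r zerosE addr0.
rewrite muls_cons hg ?mulr0 ?add0r; last first.
  by rewrite /= size_cat ltnS leq_addl.
by rewrite IH // => w hw; apply: hf.
Qed.

End SeriesModule.

Section AffineLie.
Variables (K : comNzRingType) (B : algType K).

(** The pair (s, m) stands for the affine map v |-> s v + m, or equally for the
    block matrix with first row (s, m) and second row 0. A homomorphism from a
    free Lie algebra to this Lie algebra records in its first component the
    value of a Lie polynomial in B, and in the second one its derivative. *)
Definition affine : Type := (B * B)%type.
HB.instance Definition _ := GRing.Lmodule.on affine.

Definition affine_bracket (p q : affine) : affine :=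
  (p.1 * q.1 - q.1 * p.1, p.1 * q.2 - q.1 * p.2).

Fact affine_linearl q : linear (affine_bracket^~ q).
Proof.
move=> c p p'; congr (_, _) => /=; rewrite !mulrDl !mulrDr -!scalerAl -!scalerAr;
  by rewrite scalerBr opprD addrACA.
Qed.
Fact affine_linearr p : linear (affine_bracket p).
Proof.
move=> c q q'; congr (_, _) => /=; rewrite !mulrDl !mulrDr -!scalerAl -!scalerAr;
  by rewrite scalerBr opprD addrACA.
Qed.
Fact affinexx p : affine_bracket p p = 0.
Proof. by congr (_, _) => /=; rewrite subrr. Qed.
Fact affine_jacobi p q r :
  affine_bracket p (affine_bracket q r) + affine_bracket q (affine_bracket r p)
  + affine_bracket r (affine_bracket p q) = 0.
Proof.
have cancel6 (V : zmodType) (a b c d e f : V) :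
    a - b - (c - d) + (c - e - (f - b)) + (f - d - (a - e)) = 0.
  apply/eqP; rewrite addr_eq0 !opprB !addrA subrK.
  by apply/eqP; congr (_ - f); rewrite addrAC (addrAC _ d) subrK addrAC.
congr (_, _) => /=; rewrite !mulrBl !mulrBr !mulrA; exact: cancel6.
Qed.

HB.instance Definition _ := Lmodule_isLieAlgebra.Build K affine
  affine_linearl affine_linearr affinexx affine_jacobi.

Lemma affine_br1 (p q : affine) :
  (bracket p q).1 = p.1 * q.1 - q.1 * p.1.
Proof. by []. Qed.
Lemma affine_br2 (p q : affine) :
  (bracket p q).2 = p.1 * q.2 - q.1 * p.2.
Proof. by []. Qed.

End AffineLie.

(** * Lie subalgebras, brackets and free Lie algebras *)

Section SubLie.
Variables (K : comNzRingType) (L : lieAlgType K) (P : L -> Prop).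
Hypotheses (P0 : P 0) (PZD : forall c a b, P a -> P b -> P (c *: a + b)).
Hypothesis Pbr : forall a b, P a -> P b -> P (bracket a b).

(** The closure proofs are arguments of the type so that the algebraic structures
    on it can be inferred. *)
Definition sublie_of of P 0 & (forall c a b, P a -> P b -> P (c *: a + b)) &
  (forall a b, P a -> P b -> P (bracket a b)) : Type := {a : L | P a}.
Local Notation sublie := (sublie_of P0 PZD Pbr).

Let val (u : sublie) : L := sval (u : {a | P a}).
Let valP (u : sublie) : P (val u) := svalP (u : {a | P a}).
Let inj (u v : sublie) : val u = val v -> u = v.
Proof.
case: u v => a Pa [b Pb] /= ab; subst b; congr exist; exact: Prop_irrelevance.
Qed.

Let PD a b : P a -> P b -> P (a + b).
Proof. by move=> Pa Pb; rewrite -[a]scale1r; apply: PZD. Qed.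
Let PZ c a : P a -> P (c *: a).
Proof. by move=> Pa; rewrite -[_ *: _]addr0; apply: PZD. Qed.
Let PN a : P a -> P (- a).
Proof. by rewrite -scaleN1r; apply: PZ. Qed.

HB.instance Definition _ := gen_eqMixin sublie.
HB.instance Definition _ := gen_choiceMixin sublie.

Let add (u v : sublie) : sublie := exist _ _ (PD (valP u) (valP v)).
Let opp (u : sublie) : sublie := exist _ _ (PN (valP u)).
Let zero : sublie := exist _ _ P0.
Let scale c (u : sublie) : sublie := exist _ _ (PZ c (valP u)).
Let br (u v : sublie) : sublie := exist _ _ (Pbr (valP u) (valP v)).

Fact sublie_addA : associative add.
Proof. by move=> u v w; apply: inj; apply: addrA. Qed.
Fact sublie_addC : commutative add.
Proof. by move=> u v; apply: inj; apply: addrC. Qed.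
Fact sublie_add0 : left_id zero add.
Proof. by move=> u; apply: inj; apply: add0r. Qed.
Fact sublie_addN : left_inverse zero opp add.
Proof. by move=> u; apply: inj; apply: addNr. Qed.
HB.instance Definition _ := GRing.isZmodule.Build sublie
  sublie_addA sublie_addC sublie_add0 sublie_addN.

Fact sublie_scaleA a b u : scale a (scale b u) = scale (a * b) u.
Proof. by apply: inj; apply: scalerA. Qed.
Fact sublie_scale1 : left_id 1 scale.
Proof. by move=> u; apply: inj; apply: scale1r. Qed.
Fact sublie_scaleDr : right_distributive scale +%R.
Proof. by move=> c u v; apply: inj; apply: scalerDr. Qed.
Fact sublie_scaleDl u : {morph scale^~ u : a b / a + b}.
Proof. by move=> a b; apply: inj; apply: scalerDl. Qed.
HB.instance Definition _ := GRing.Zmodule_isLmodule.Build K sublie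
  sublie_scaleA sublie_scale1 sublie_scaleDr sublie_scaleDl.

Fact sublie_linearl v : linear (br^~ v).
Proof. by move=> c u u'; apply: inj; apply: bracket_linearl. Qed.
Fact sublie_linearr u : linear (br u).
Proof. by move=> c v v'; apply: inj; apply: bracket_linearr. Qed.
Fact subliexx u : br u u = 0.
Proof. by apply: inj; apply: bracketxx. Qed.
Fact sublie_jacobi u v w : br u (br v w) + br v (br w u) + br w (br u v) = 0.
Proof. by apply: inj; apply: bracket_jacobi. Qed.
HB.instance Definition _ := Lmodule_isLieAlgebra.Build K sublie
  sublie_linearl sublie_linearr subliexx sublie_jacobi.

Definition sublie_val (u : sublie) : L := val u.
Fact sublie_val_linear : linear sublie_val. Proof. by []. Qed.
HB.instance Definition _ :=
  GRing.isLinear.Build K sublie L *:%R sublie_val sublie_val_linear.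
Fact sublie_val_bracket :
  {morph sublie_val : a b / bracket a b >-> bracket a b}.
Proof. by []. Qed.
HB.instance Definition _ :=
  isBracketMorphism.Build K sublie L sublie_val sublie_val_bracket.
Definition sublie_incl : {lie sublie -> L} := sublie_val.
End SubLie.

Section LieIdentity.
Variables (K : comNzRingType) (L : lieAlgType K).
Fact lie_id_bracket : {morph (@idfun L) : a b / bracket a b >-> bracket a b}.
Proof. by []. Qed.
HB.instance Definition _ := isBracketMorphism.Build K L L idfun lie_id_bracket.
Definition lie_id : {lie L -> L} := idfun.
End LieIdentity.

Section BracketTheory.
Variables (K : comNzRingType) (L : lieAlgType K).
Implicit Types a b c : L.
Lemma brDl a a' b : bracket (a + a') b = bracket a b + bracket a' b.
Proof. by have := bracket_linearl b 1 a a'; rewrite !scale1r. Qed.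
Lemma brDr a b b' : bracket a (b + b') = bracket a b + bracket a b'.
Proof. by have := bracket_linearr a 1 b b'; rewrite !scale1r. Qed.
Lemma br0l b : bracket 0 b = 0.
Proof. by apply: (addrI (bracket 0 b)); rewrite -brDl !addr0. Qed.
Lemma br0r a : bracket a 0 = 0.
Proof. by apply: (addrI (bracket a 0)); rewrite -brDr !addr0. Qed.
Lemma brZl k a b : bracket (k *: a) b = k *: bracket a b.
Proof. by have := bracket_linearl b k a 0; rewrite br0l !addr0. Qed.
Lemma brZr k a b : bracket a (k *: b) = k *: bracket a b.
Proof. by have := bracket_linearr a k b 0; rewrite br0r !addr0. Qed.
Lemma brNl a b : bracket (- a) b = - bracket a b.
Proof. by rewrite -scaleN1r brZl scaleN1r. Qed.
Lemma brC a b : bracket a b = - bracket b a.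
Proof.
apply/eqP; rewrite -addr_eq0; have := bracketxx (a + b).
by rewrite brDl !brDr !bracketxx add0r addr0 => ->.
Qed.
Lemma br_scale2 k l a : bracket (k *: a) (l *: a) = 0.
Proof. by rewrite brZl brZr bracketxx !scaler0. Qed.
End BracketTheory.

Section LieMorphismTheory.
Variables (K : comNzRingType) (L M : lieAlgType K) (f : {lie L -> M}).
Lemma lieP c a b : f (c *: a + b) = c *: f a + f b.
Proof. exact: linearP. Qed.
Lemma lie0 : f 0 = 0. Proof. exact: raddf0. Qed.
Lemma lieD a b : f (a + b) = f a + f b. Proof. exact: raddfD. Qed.
Lemma lieN a : f (- a) = - f a. Proof. exact: raddfN. Qed.
Lemma lieZ c a : f (c *: a) = c *: f a. Proof. exact: linearZ. Qed.
Lemma lieBr a b : f (bracket a b) = bracket (f a) (f b).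
Proof. exact: bracket_morph. Qed.
End LieMorphismTheory.

Section Free.
Variables (K : comNzRingType) (F : lieAlgType K) (n : nat) (x : 'I_n -> F).
Hypothesis hx : freely_generates x.

(** The elements satisfying P form a Lie subalgebra S that contains the
    generators; the composite F -> S -> F fixes the generators, so it is the
    identity by uniqueness. *)
Lemma lie_ind (P : F -> Prop) : P 0 -> (forall i, P (x i)) ->
  (forall c a b, P a -> P b -> P (c *: a + b)) ->
  (forall a b, P a -> P b -> P (bracket a b)) -> forall a, P a.
Proof.
move=> P0 Px PZD Pbr a.
pose S := sublie_of P0 PZD Pbr : lieAlgType K.
have [f [fx _]] := hx (fun i => exist P (x i) (Px i) : S).
have [g [_ gu]] := hx x.
have <- : lie_comp (sublie_incl P0 PZD Pbr) f a = a.
  have /gu <- : forall i, lie_comp (sublie_incl P0 PZD Pbr) f (x i) = x i.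
    by move=> i; rewrite /lie_comp /= fx.
  by have /gu -> : forall i, lie_id F (x i) = x i by [].
exact: (svalP (f a : {b | P b})).
Qed.

Definition ext (L : lieAlgType K) (y : 'I_n -> L) : {lie F -> L} :=
  sval (cid (hx y)).

Lemma ext_gen (L : lieAlgType K) (y : 'I_n -> L) i : ext y (x i) = y i.
Proof. by rewrite /ext; case: cid => f [/= fx _]; apply: fx. Qed.

Lemma lie_eq (L : lieAlgType K) (f g : {lie F -> L}) :
  (forall i, f (x i) = g (x i)) -> f =1 g.
Proof.
move=> fg a; have [h [_ hu]] := hx (fun i => g (x i)).
by rewrite -(hu f) // (hu g).
Qed.

Lemma ext0 (L : lieAlgType K) a : ext (fun=> 0 : L) a = 0.
Proof.
elim/lie_ind: a => [|i|c a b ea eb|a b ea eb].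
- exact: lie0.
- exact: ext_gen.
- by rewrite lieP ea eb scaler0 addr0.
- by rewrite lieBr ea br0l.
Qed.
End Free.

(** * Lyndon words and their bracketings *)

Section Lex.
Variable n : nat.
Implicit Types u v w p s z : seq 'I_n.

Fixpoint lexlt u v : bool :=
  match u, v with
  | _, [::] => false
  | [::], _ :: _ => true
  | a :: u', b :: v' => (a < b)%N || (a == b) && lexlt u' v'
  end.

Lemma lexlt_irr u : lexlt u u = false.
Proof. by elim: u => //= a u ->; rewrite ltnn eqxx. Qed.

Lemma lexlt_trans : transitive lexlt.
Proof.
move=> v u w; elim: v u w => [|b v IH] [|a u] [|c w] //=.
case/orP=> [ab|/andP[/eqP-> uv]]; case/orP=> [bc|/andP[/eqP<- vw]].
- by rewrite (ltn_trans ab bc).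
- by rewrite ab.
- by rewrite bc.
- by rewrite eqxx (IH u w) ?orbT.
Qed.

Lemma lexlt_total u v : [|| lexlt u v, u == v | lexlt v u].
Proof.
elim: u v => [|a u IH] [|b v] //=; rewrite eqseq_cons.
case: (ltngtP a b) => [//|_|/val_inj ->]; first by rewrite !orbT.
by rewrite eqxx /=; apply: IH.
Qed.

Lemma lexlt_asym u v : lexlt u v -> lexlt v u = false.
Proof. by move=> uv; apply/negP => /(lexlt_trans uv); rewrite lexlt_irr. Qed.

Lemma lexlt_catl p u v : lexlt (p ++ u) (p ++ v) = lexlt u v.
Proof. by elim: p => //= a p ->; rewrite ltnn eqxx. Qed.

Lemma lexlt_prefix u z : z != [::] -> lexlt u (u ++ z).
Proof. by rewrite -{1}[u]cats0 lexlt_catl; case: z. Qed.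

(** In the second case u < v is decided at a position inside both words, hence
    is insensitive to what follows. *)
Lemma lexlt_cat u v : lexlt u v ->
  (exists2 z, z != [::] & v = u ++ z) \/
  (forall s s', lexlt (u ++ s) (v ++ s')).
Proof.
elim: u v => [|a u IH] [|b v] //=; first by left; exists (b :: v).
case/orP=> [ab|/andP[/eqP-> uv]]; first by right=> s s'; rewrite ab.
case: (IH v uv) => [[z z0 ->]|h]; first by left; exists z.
by right=> s s'; rewrite h eqxx orbT.
Qed.

Lemma lexlt_cat_size u v s s' : lexlt u v -> (size v <= size u)%N ->
  lexlt (u ++ s) (v ++ s').
Proof.
move=> uv le_vu; case: (lexlt_cat uv) => [[z z0 vE]|-> //].
by move: le_vu; rewrite vE size_cat -subn_eq0 addKn size_eq0 (negPf z0).
Qed.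

Lemma lexle_cat u v w w' : size w = size u -> ~~ lexlt w u -> ~~ lexlt w' v ->
  ~~ lexlt (w ++ w') (u ++ v).
Proof.
move=> sz; have := lexlt_total w u; case: (lexlt w u) => //=.
case/orP=> [/eqP-> _|uw _ _]; first by rewrite lexlt_catl.
by rewrite (lexlt_asym (lexlt_cat_size _ _ uw _)) ?sz.
Qed.

Definition lyndon w := forall y z, w = y ++ z -> y != [::] -> z != [::] ->
  lexlt w z.

Lemma lyndon_cat_lt u v : u != [::] -> lyndon v -> lexlt u v ->
  lexlt (u ++ v) v.
Proof.
move=> u0 lv uv; case: (lexlt_cat uv) => [[z z0 vE]|h].
  by rewrite {2}vE lexlt_catl; apply: lv vE u0 z0.
by have := h v [::]; rewrite cats0.
Qed.

Lemma cat_suffix u v y z : u ++ v = y ++ z -> y != [::] ->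
  [\/ exists2 y', v = y' ++ z & y' != [::], z = v |
      exists y1, [/\ u = y ++ y1, y1 != [::] & z = y1 ++ v]].
Proof.
elim: u y => [|a u IH] y /=.
  by move=> -> y0; constructor 1; exists y.
case: y => [//|b y] [ab uv] _; subst b.
have [y0|y0] := eqVneq y [::].
  subst y; rewrite /= in uv; have [u0|u0] := eqVneq u [::].
    by constructor 2; rewrite -uv u0.
  by constructor 3; exists u; rewrite -uv.
case: (IH y uv y0) => [[y' vE y'0]||[y1 [uE y10 zE]]].
- by constructor 1; exists y'.
- by constructor 2.
- by constructor 3; exists y1; rewrite uE.
Qed.

(** A proper suffix z of u ++ v either is v or a suffix of v, whence
    u ++ v < v <= z, or it is y1 ++ v with y1 a suffix of u, and then u < y1 is
    decided inside the shorter word y1. *)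
Lemma lyndon_cat u v : u != [::] -> v != [::] -> lyndon u -> lyndon v ->
  lexlt u v -> lyndon (u ++ v).
Proof.
move=> u0 v0 lu lv uv y z E y0 z0; have uvv := lyndon_cat_lt u0 lv uv.
case: (cat_suffix E y0) => [[y' vE y'0]|->//|[y1 [uE y10 ->]]].
  exact: lexlt_trans uvv (lv _ _ vE y'0 z0).
have := lu _ _ uE y0 y10 => uy1.
have sz : (size y1 <= size u)%N by rewrite uE size_cat leq_addl.
exact: lexlt_cat_size uy1 sz.
Qed.

(** A termination measure: among words of bounded length only finitely many
    lie below a given one. *)
Definition lexrank N v := #|[set b : N.-bseq 'I_n | lexlt b v]|.

Lemma lexrank_lt N u v : lexlt u v -> (size u <= N)%N ->
  (lexrank N u < lexrank N v)%N.
Proof.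
move=> uv szu; apply: proper_card; apply/properP; split.
  by apply/subsetP => b; rewrite !inE => /lexlt_trans; apply.
by exists (Bseq szu); rewrite inE //= lexlt_irr.
Qed.

Inductive tree := Leaf of 'I_n | Node of tree & tree.

Fixpoint leaves t : seq 'I_n :=
  if t is Node a b then leaves a ++ leaves b else
  if t is Leaf i then [:: i] else [::].

(** The conditions say that (leaves a, leaves b) is the standard factorization
    of the Lyndon word leaves a ++ leaves b. Stating them on trees avoids
    defining the factorization of a word. *)
Fixpoint good t : bool :=
  if t is Node a b then
    [&& good a, good b, lexlt (leaves a) (leaves b) &
      if a is Node _ d then ~~ lexlt (leaves d) (leaves b) else true]
  else true.

Lemma leaves_neq0 t : leaves t != [::].
Proof. by elim: t => //= a IHa b _; case: (leaves a) IHa. Qed.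

Lemma good_lyndon t : good t -> lyndon (leaves t).
Proof.
elim: t => [i _ [|b y] z //= |a IHa b IHb /= /and4P[ga gb ab _]].
  by case=> _; case: y => //= <-.
by apply: lyndon_cat; rewrite ?leaves_neq0 //; [apply: IHa | apply: IHb].
Qed.

Lemma lexle_trans u v w : ~~ lexlt v u -> ~~ lexlt w v -> ~~ lexlt w u.
Proof.
move=> uv vw; apply/negP => wu; have /or3P[] := lexlt_total u v.
- by move=> /(lexlt_trans wu); apply/negP.
- by move/eqP => E; rewrite -E wu in vw.
- exact/negP.
Qed.

(** A suffix y1 ++ leaves b, with y1 a proper suffix of the leaves of
    a = Node a1 a2, is handled by induction: leaves a2 <= y1, and
    leaves b <= leaves a2 by the last condition in [good]. *)
Lemma good_min_suffix t y z : good t -> leaves t = y ++ z ->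
  y != [::] -> z != [::] -> if t is Node _ b then ~~ lexlt z (leaves b) else true.
Proof.
elim: t y z => [//|a IHa b _] y z /= /and4P[ga gb _ le] E y0 z0.
case: (cat_suffix E y0) => [[y' bE y'0]|->|[y1 [aE y10 ->]]].
- by rewrite (lexlt_asym (good_lyndon gb bE y'0 z0)).
- by rewrite lexlt_irr.
case: a IHa ga le aE {E} => [i|a1 a2] IHa ga le aE.
  by case: y aE y0 => [//|? [|??]] [] //=; case: y1 y10.
have h := lexle_trans le (IHa _ _ ga aE y0 y10).
apply: contra h; apply: lexlt_trans; exact: lexlt_prefix (leaves_neq0 b).
Qed.

(** The right factor is the least proper suffix of the word, so the word
    determines both factors. *)
Lemma good_leaves_inj t t' : good t -> good t' -> leaves t = leaves t' -> t = t'.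
Proof.
elim: t t' => [i|a IHa b IHb] [j|a' b'] // g g'.
- by case=> ->.
- move=> E; have := congr1 size E; move: (leaves_neq0 a') (leaves_neq0 b').
  by rewrite /= size_cat; case: (leaves a') (leaves b') => [|? ?] [|? ?] //=;
    rewrite addnS.
- move=> E; have := congr1 size E; move: (leaves_neq0 a) (leaves_neq0 b).
  by rewrite /= size_cat; case: (leaves a) (leaves b) => [|? ?] [|? ?] //=;
    rewrite addnS.
move=> E.
have h1 := good_min_suffix g E (leaves_neq0 _) (leaves_neq0 _).
have h2 := good_min_suffix g' (esym E) (leaves_neq0 _) (leaves_neq0 _).
have Eb : leaves b = leaves b'.
  by have := lexlt_total (leaves b) (leaves b');
    rewrite (negPf h1) (negPf h2) orbF => /eqP.
have Ea : leaves a = leaves a'.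
  have sz : size (leaves a) = size (leaves a').
    by have := congr1 size E; rewrite /= !size_cat Eb => /addIn.
  by move: E => /= /eqP; rewrite Eb eqseq_cat // eqxx andbT => /eqP.
by move: g g' => /= /and4P[? ? _ _] /and4P[? ? _ _]; rewrite (IHa a') // (IHb b').
Qed.
End Lex.

(** * The free Lie algebra embeds into noncommutative series *)

Section Embedding.
Variables (K : comNzRingType) (F : lieAlgType K) (n : nat) (x : 'I_n -> F).
Hypothesis hx : freely_generates x.
Local Notation A := (series 'I_n K^o).

Definition letter (i : 'I_n) : A := fun w => (w == [:: i])%:R.

Lemma mul_letter_cons i (f : A) a w :
  (letter i * f) (a :: w) = (a == i)%:R * f w.
Proof.
rewrite muls_cons mul0r add0r (@muls_homogl _ _ _ _ _ 0%N).
  by rewrite take0 drop0 /lder /letter eqseq_cons eqxx andbT.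
by case=> // b v _; rewrite /lder /letter eqseq_cons andbF.
Qed.

Definition emb_pair : {lie F -> affine A} :=
  ext hx (fun i => (letter i, 0) : affine A).
Definition emb (u : F) : A := (emb_pair u).1.

Lemma embP c u v : emb (c *: u + v) = c *: emb u + emb v.
Proof. by rewrite /emb lieP. Qed.
Lemma emb0 : emb 0 = 0. Proof. by rewrite /emb lie0. Qed.
Lemma embD u v : emb (u + v) = emb u + emb v.
Proof. by rewrite /emb lieD. Qed.
Lemma embZ c u : emb (c *: u) = c *: emb u.
Proof. by rewrite /emb lieZ. Qed.
Lemma embN u : emb (- u) = - emb u.
Proof. by rewrite /emb lieN. Qed.
Lemma emb_gen i : emb (x i) = letter i.
Proof. by rewrite /emb /emb_pair ext_gen. Qed.
Lemma embBr u v : emb (bracket u v) = emb u * emb v - emb v * emb u.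
Proof. by rewrite /emb lieBr. Qed.
Lemma emb_nil u : emb u [::] = 0.
Proof.
elim/(lie_ind hx): u => [|i|c u v hu hv|u v hu hv].
- by rewrite emb0.
- by rewrite emb_gen.
- by rewrite embP addsE scalesE hu hv scaler0 addr0.
- by rewrite embBr addsE oppsE !muls_nil hu hv mulr0 subr0.
Qed.

Fixpoint lie_of (t : tree n) : F :=
  match t with Leaf i => x i | Node a b => bracket (lie_of a) (lie_of b) end.

Lemma lie_of_homog t w : size w != size (leaves t) -> emb (lie_of t) w = 0.
Proof.
elim: t w => [i|a IHa b IHb] w.
  by rewrite /= emb_gen /letter; have [->|] := eqVneq w [:: i].
rewrite /= size_cat embBr addsE oppsE => sz.
rewrite (muls_homogl _ _ IHa) (muls_homogl _ _ IHb).
rewrite (_ : (if _ then _ else _) = 0) ?sub0r; last first.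
  case: ifP => // le; rewrite IHb ?mulr0 // size_drop.
  by apply: contra sz => /eqP <-; rewrite subnKC.
rewrite (_ : (if _ then _ else _) = 0) ?oppr0 //.
case: ifP => // le; rewrite IHa ?mulr0 // size_drop.
by apply: contra sz => /eqP <-; rewrite subnK.
Qed.

(** With u < v the words of the two trees, u v < v <= v u, so the product in the
    order v, u contributes only words strictly above u v. *)
Lemma lie_of_lead t : good t -> emb (lie_of t) (leaves t) = 1 /\
  (forall w, emb (lie_of t) w != 0 -> ~~ lexlt w (leaves t)).
Proof.
elim: t => [i _|a IHa b IHb].
  rewrite /= emb_gen /letter eqxx; split=> // w.
  by have [->|_] := eqVneq w; rewrite ?lexlt_irr // eqxx.
move=> /= /and4P[ga gb ab _].
have [a1 alt] := IHa ga; have [b1 blt] := IHb gb.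
have lt_vu : lexlt (leaves a ++ leaves b) (leaves b ++ leaves a).
  have := lexlt_cat_size [::] (leaves a)
    (lyndon_cat_lt (leaves_neq0 a) (good_lyndon gb) ab).
  by rewrite cats0; apply; rewrite size_cat leq_addl.
have prod_lt (c d : tree n) w :
    (forall w, emb (lie_of c) w != 0 -> ~~ lexlt w (leaves c)) ->
    (forall w, emb (lie_of d) w != 0 -> ~~ lexlt w (leaves d)) ->
    (emb (lie_of c) * emb (lie_of d)) w != 0 -> ~~ lexlt w (leaves c ++ leaves d).
  move=> hc hd; rewrite (muls_homogl _ _ (@lie_of_homog c)).
  case: ifP => le; rewrite ?eqxx // => nz;
    rewrite -[w](cat_take_drop (size (leaves c))).
  apply: lexle_cat; first by rewrite size_takel.
  - by apply: hc; apply: contraNneq nz => ->; rewrite mul0r.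
  - by apply: hd; apply: contraNneq nz => ->; rewrite mulr0.
rewrite embBr; split.
  rewrite addsE oppsE (muls_homogl _ _ (@lie_of_homog a)) size_cat leq_addr.
  rewrite take_size_cat // drop_size_cat // a1 b1 mulr1.
  have [->|/prod_lt h] := eqVneq ((emb (lie_of b) * emb (lie_of a)) (leaves a
    ++ leaves b)) 0.
    by rewrite subr0.
  by have := h blt alt; rewrite lt_vu.
move=> w nz; have [E|/prod_lt h] := eqVneq ((emb (lie_of a) * emb (lie_of b)) w) 0.
  have /prod_lt h : (emb (lie_of b) * emb (lie_of a)) w != 0.
    by apply: contraNneq nz => E'; rewrite addsE oppsE E E' subr0.
  by apply: contra (h blt alt) => /lexlt_trans; apply.
exact: h.
Qed.

Inductive in_span (Q : tree n -> Prop) : F -> Prop :=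
| in_span0 : in_span Q 0
| in_spanS c t a : Q t -> in_span Q a -> in_span Q (c *: lie_of t + a).

Lemma in_span_gen Q t : Q t -> in_span Q (lie_of t).
Proof. by rewrite -[lie_of t]scale1r -[_ *: _]addr0 => ?;
  apply: in_spanS => //; apply: in_span0. Qed.
Lemma in_spanD Q a b : in_span Q a -> in_span Q b -> in_span Q (a + b).
Proof.
by elim=> [|c t {}a Qt _ IH] hb; rewrite ?add0r // -addrA; apply: in_spanS (IH hb).
Qed.
Lemma in_spanZ Q c a : in_span Q a -> in_span Q (c *: a).
Proof.
elim=> [|d t {}a Qt _ IH]; first by rewrite scaler0; apply: in_span0.
by rewrite scalerDr scalerA; apply: in_spanS.
Qed.
Lemma in_spanN Q a : in_span Q a -> in_span Q (- a).
Proof. by rewrite -scaleN1r; apply: in_spanZ. Qed.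
Lemma in_spanW (Q Q' : tree n -> Prop) a : (forall t, Q t -> Q' t) ->
  in_span Q a -> in_span Q' a.
Proof.
by move=> QQ'; elim=> [|c t {}a Qt _ IH];
  [apply: in_span0 | apply: in_spanS (QQ' _ Qt) IH].
Qed.
Lemma in_span_br Q Q' Q'' a b : (forall t t', Q t -> Q' t' ->
  in_span Q'' (bracket (lie_of t) (lie_of t'))) ->
  in_span Q a -> in_span Q' b -> in_span Q'' (bracket a b).
Proof.
move=> h; elim=> [|c t {}a Qt _ IH] hb; first by rewrite br0l; apply: in_span0.
rewrite brDl brZl; apply: in_spanD (IH hb); apply: in_spanZ.
elim: hb {IH} => [|d t' {}b Qt' _ IH']; first by rewrite br0r; apply: in_span0.
by rewrite brDr brZr; apply: in_spanD (IH'); apply: in_spanZ; apply: h.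
Qed.

Definition below N v (t : tree n) :=
  [/\ good t, size (leaves t) = N & lexlt (leaves t) v].

(** Rewriting of a bracket of two Lyndon bracketings. If Node t1 t2 violates the
    last condition of [good], then t1 = Node a b with b < t2, and
    [[a, b], t2] = [[a, t2], b] + [a, [b, t2]]. The inner brackets have smaller
    total length, and by induction they involve only trees below t2, so both
    outer brackets are between trees below t2: the larger of the two words has
    decreased, at constant total length. *)
Lemma lie_of_pair N : (forall t1 t2, (size (leaves t1) + size (leaves t2) = N)%N ->
  good t1 -> good t2 -> lexlt (leaves t1) (leaves t2) ->
  in_span (below N (leaves t2)) (bracket (lie_of t1) (lie_of t2))).
Proof.
have [M leNM] := ubnP N; elim: M => // M IHM in N leNM *.
move=> t1 t2; have [r] := ubnP (lexrank N (leaves t2)).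
elim: r => // r IHr in t1 t2 *.
rewrite ltnS => ler sz g1 g2 t12.
have base : good (Node t1 t2) -> in_span (below N (leaves t2)) (bracket (lie_of
  t1) (lie_of t2)).
  move=> g; apply: (@in_span_gen _ (Node t1 t2)); split=> //=.
    by rewrite size_cat.
  exact: lyndon_cat_lt (leaves_neq0 _) (good_lyndon g2) t12.
case: t1 sz g1 t12 base => [i|a b] sz g1 t12 base; first by apply: base;
  apply/and4P.
have [bt2|bt2] := boolP (lexlt (leaves b) (leaves t2)); last by apply: base;
  apply/and4P.
move: g1 => /= /and4P[ga gb ab _].
have at2 := lexlt_trans ab bt2.
have szpos (t : tree n) : (0 < size (leaves t))%N by rewrite lt0n size_eq0
  leaves_neq0.
have pairs d e : (size (leaves d) + size (leaves e) = N)%N -> good d -> good e ->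
    lexlt (leaves d) (leaves t2) -> lexlt (leaves e) (leaves t2) ->
    in_span (below N (leaves t2)) (bracket (lie_of d) (lie_of e)).
  have half d' e' : (size (leaves d') + size (leaves e') = N)%N -> good d' ->
    good e' ->
      lexlt (leaves e') (leaves t2) -> lexlt (leaves d') (leaves e') ->
      in_span (below N (leaves t2)) (bracket (lie_of d') (lie_of e')).
    move=> szd gd ge et2 de.
    have rk : (lexrank N (leaves e') < r)%N.
      by apply: leq_trans ler; apply: lexrank_lt => //; rewrite -szd leq_addl.
    apply: in_spanW (IHr _ _ rk szd gd ge de) => t [gt szt tlt].
    by split=> //; apply: lexlt_trans tlt et2.
  move=> szd gd ge dt2 et2; case/or3P: (lexlt_total (leaves d) (leaves e)) =>
    [de|/eqP de|ed].
  - exact: half.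
  - by rewrite (good_leaves_inj gd ge de) bracketxx; apply: in_span0.
  - by rewrite brC; apply: in_spanN; apply: half; rewrite // addnC.
have jac : bracket (bracket (lie_of a) (lie_of b)) (lie_of t2) =
    bracket (bracket (lie_of a) (lie_of t2)) (lie_of b) +
    bracket (lie_of a) (bracket (lie_of b) (lie_of t2)).
  have := bracket_jacobi (lie_of a) (lie_of b) (lie_of t2).
  rewrite (brC _ (bracket (lie_of a) (lie_of b))) (brC (lie_of b) (bracket _ _)).
  rewrite (brC (lie_of t2) (lie_of a)) brNl opprK.
  by move/eqP; rewrite subr_eq0 addrC => /eqP <-.
rewrite /= jac; rewrite /= size_cat in sz.
have leN k m : (k + m = N)%N -> (0 < m)%N -> (k < M)%N.
  by move=> E m0; apply: leq_trans (leNM : (N <= M)%N); rewrite -E -addn1 leq_add2l.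
apply: in_spanD.
  have szab : (size (leaves a) + size (leaves t2) + size (leaves b) = N)%N by
    rewrite -sz addnAC.
  apply: (in_span_br (Q := below (size (leaves a) + size (leaves t2)) (leaves
    t2)) (Q' := eq b)).
  - move=> d _ [gd szd dt2] <-; apply: pairs => //; by rewrite szd.
  - by apply: IHM => //; apply: leN szab _.
  - exact: in_span_gen.
have szab : (size (leaves b) + size (leaves t2) + size (leaves a) = N)%N by
  rewrite -sz addnC addnA.
apply: (in_span_br (Q := eq a) (Q' := below (size (leaves b) + size (leaves
  t2)) (leaves t2))).
- move=> _ d <- [gd szd dt2]; apply: pairs => //; by rewrite szd addnC.
- exact: in_span_gen.
- by apply: IHM => //; apply: leN szab _.
Qed.

Lemma good_span u : in_span (fun t => good t) u.
Proof.
elim/(lie_ind hx): u => [|i|c u v hu hv|u v].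
- exact: in_span0.
- exact: (@in_span_gen _ (Leaf i)).
- by apply: in_spanD => //; apply: in_spanZ.
apply: in_span_br => t t' gt gt'.
case/or3P: (lexlt_total (leaves t) (leaves t')) => [tt'|/eqP tt'|t't].
- by apply: in_spanW (lie_of_pair erefl gt gt' tt') => ? [].
- by rewrite (good_leaves_inj gt gt' tt') bracketxx; apply: in_span0.
- by rewrite brC; apply: in_spanN; apply: in_spanW (lie_of_pair erefl gt' gt
  t't) => ? [].
Qed.

HB.instance Definition _ := gen_eqMixin (tree n).

Definition comb (r : seq (K * tree n)) : F := \sum_(p <- r) p.1 *: lie_of p.2.

Lemma in_span_comb u : in_span (fun t => good t) u ->
  exists2 r, all (fun p => good p.2) r & u = comb r.
Proof.
elim=> [|c t {}u gt _ [r gr ->]]; first by exists [::]; rewrite // /comb big_nil.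
by exists ((c, t) :: r); rewrite /= ?gt // /comb big_cons.
Qed.

Lemma emb_comb r w :
  emb (comb r) w = \sum_(p <- r) p.1 * (emb (lie_of p.2) w : K).
Proof.
rewrite /comb; elim: r => [|p r IH]; first by rewrite !big_nil emb0.
by rewrite !big_cons embP addsE IH.
Qed.

Lemma least_leaves (r : seq (K * tree n)) : r != [::] ->
  exists2 p, p \in r & {in r, forall q, ~~ lexlt (leaves q.2) (leaves p.2)}.
Proof.
elim: r => // p [|p' r] IH _.
  by exists p; rewrite ?mem_head // => q; rewrite inE => /eqP->; rewrite lexlt_irr.
have [//|q qr qmin] := IH.
have [qp|pq] := boolP (lexlt (leaves p.2) (leaves q.2)); last first.
  exists q; first by rewrite inE qr orbT.
  by move=> q'; rewrite inE => /predU1P[->//|/qmin].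
exists p; first exact: mem_head.
move=> q'; rewrite inE => /predU1P[->|/qmin]; first by rewrite lexlt_irr.
by apply: contra => /lexlt_trans; apply.
Qed.

(** In a combination of Lyndon bracketings that maps to 0, the least word
    occurs in the image of no other tree, so its total coefficient vanishes; its
    terms can be dropped from the combination. *)
Lemma emb_inj0 u : emb u = 0 -> u = 0.
Proof.
have [r gr -> {u}] := in_span_comb (good_span u).
have [m] := ubnP (size r); elim: m => // m IH in r gr * => szr r0.
have [->|rn] := eqVneq r [::]; first by rewrite /comb big_nil.
have [p pr pmin] := least_leaves rn; have good_r q : q \in r ->
  good q.2 by move/(allP gr).
have [p1 _] := lie_of_lead (good_r _ pr).
pose P (q : K * tree n) := leaves q.2 == leaves p.2.
have combE : comb r = (\sum_(q <- r | P q) q.1) *: lie_of p.2 +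
    comb [seq q <- r | ~~ P q].
  rewrite /comb (bigID P) /= big_filter scaler_suml; congr (_ + _).
  rewrite big_seq_cond [RHS]big_seq_cond; apply: eq_bigr => q /andP[qr /eqP qp].
  by rewrite (good_leaves_inj (good_r _ qr) (good_r _ pr) qp).
have c0 : \sum_(q <- r | P q) q.1 = 0.
  have := congr1 (fun f : A => f (leaves p.2)) r0.
  rewrite /= emb_comb zerosE (bigID P) /= [X in _ + X]big1_seq ?addr0.
    move=> E; rewrite -[RHS]E big_seq_cond [RHS]big_seq_cond; apply: eq_bigr => q.
    case/andP=> qr /eqP qp.
    by rewrite (good_leaves_inj (good_r _ qr) (good_r _ pr) qp) p1 mulr1.
  move=> q /andP[Pq qr]; have [_ hq] := lie_of_lead (good_r _ qr).
  have [->|/hq] := eqVneq (emb (lie_of q.2) (leaves p.2)) 0; first by rewrite mulr0.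
  have := lexlt_total (leaves q.2) (leaves p.2).
  by rewrite (negPf (pmin _ qr)) /= -[_ == _]/(P q) (negPf Pq) /= => ->.
rewrite combE c0 scale0r add0r; apply: IH.
- by apply/allP => q; rewrite mem_filter => /andP[_ /good_r].
- rewrite -ltnS; apply: leq_trans szr; rewrite ltnS size_filter.
  rewrite -(count_predC (fun q => ~~ P q) r) -addn1 leq_add2l -has_count.
  by apply/hasP; exists p; rewrite //= /P eqxx.
- by rewrite -r0 combE c0 scale0r add0r.
Qed.

Lemma emb_inj : injective emb.
Proof.
move=> u v uv; apply/eqP; rewrite -subr_eq0; apply/eqP/emb_inj0.
by rewrite embD embN uv subrr.
Qed.

End Embedding.

(** * Linear coefficients and noncommutative derivatives *)

Section FreeCalculus.
Variables (K : idomainType) (F : lieAlgType K) (n : nat) (x : 'I_n -> F).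
Hypothesis hx : freely_generates x.
Local Notation A := (series 'I_n K^o).
Local Notation emb := (emb hx).
Local Notation letter := (@letter K n).

Definition lincoef (u : F) (i : 'I_n) : K := emb u [:: i].

Lemma lincoefP c u v i : lincoef (c *: u + v) i = c * lincoef u i + lincoef v i.
Proof. by rewrite /lincoef embP. Qed.
Lemma lincoef0 i : lincoef 0 i = 0. Proof. by rewrite /lincoef emb0. Qed.
Lemma lincoefZ c u i : lincoef (c *: u) i = c * lincoef u i.
Proof. by rewrite /lincoef embZ. Qed.
Lemma lincoef_gen i j : lincoef (x i) j = (i == j)%:R.
Proof. by rewrite /lincoef emb_gen /letter eqseq_cons andbT eq_sym. Qed.
Lemma lincoef_br u v i : lincoef (bracket u v) i = 0.
Proof.
rewrite /lincoef embBr addsE oppsE.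
by rewrite !muls_cons !muls_nil /lder !emb_nil !mul0r !mulr0 !addr0 subr0.
Qed.

Lemma lincoef_comp (nu : {lie F -> F}) u j :
  lincoef (nu u) j = \sum_i lincoef u i * lincoef (nu (x i)) j.
Proof.
elim/(lie_ind hx): u => [|i|c u v hu hv|u v _ _].
- by rewrite lie0 lincoef0 big1 // => i _; rewrite lincoef0 mul0r.
- rewrite (bigD1 i) //= lincoef_gen eqxx mul1r big1 ?addr0 // => k ki.
  by rewrite lincoef_gen eq_sym (negPf ki) mul0r.
- rewrite lieP lincoefP hu hv mulr_sumr -big_split; apply: eq_bigr => i _ /=.
  by rewrite lincoefP mulrDl mulrA.
- by rewrite lieBr lincoef_br big1 // => i _; rewrite lincoef_br mul0r.
Qed.

(** The image lies in a line, where all brackets vanish, so only the linear part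
    of u matters. *)
Lemma line_hom (L : lieAlgType K) (f : {lie F -> L}) (c : 'I_n -> K) (a : L) u :
  (forall i, f (x i) = c i *: a) -> f u = (\sum_i lincoef u i * c i) *: a.
Proof.
move=> fx; elim/(lie_ind hx): u => [|i|k u v hu hv|u v hu hv].
- by rewrite lie0 big1 ?scale0r // => i _; rewrite lincoef0 mul0r.
- rewrite fx (bigD1 i) //= lincoef_gen eqxx mul1r big1 ?addr0 // => j ji.
  by rewrite lincoef_gen eq_sym (negPf ji) mul0r.
- rewrite lieP hu hv scalerA -scalerDl mulr_sumr -big_split; congr (_ *: _).
  by apply: eq_bigr => i _; rewrite lincoefP mulrDl mulrA.
- rewrite lieBr hu hv br_scale2 big1 ?scale0r // => i _.
  by rewrite lincoef_br mul0r.
Qed.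

(** The i-th Fox derivative: as emb u has no constant term, it is the sum of the
    products (der i u) * (letter i), and words ending in i give der i u. *)
Definition der (i : 'I_n) (u : F) : A := rder i (emb u).

Lemma derP i c u v : der i (c *: u + v) = c *: der i u + der i v.
Proof. by rewrite /der embP. Qed.
Lemma der0 i : der i 0 = 0.
Proof. by rewrite /der emb0. Qed.
Lemma derZ i c u : der i (c *: u) = c *: der i u.
Proof. by rewrite /der embZ. Qed.
Lemma der_gen i j : der i (x j) = (i == j)%:R.
Proof.
rewrite /der emb_gen; apply/funext => w; rewrite /rder /letter.
have [<-|ij] := eqVneq i j.
  by rewrite mulr1n ones_E; case: w => [|a [|b w]];
    rewrite /= ?eqseq_cons ?eqxx ?andbF.
by case: w => [|a [|b w]]; rewrite /= eqseq_cons ?(negPf ij) ?andbF.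
Qed.
Lemma derBr i u v :
  der i (bracket u v) = emb u * der i v - emb v * der i u.
Proof.
apply/funext => w; rewrite /der /rder embBr !addsE !oppsE !muls_rcons.
by rewrite !emb_nil !mulr0 !addr0.
Qed.

Lemma emb_der_inj u v : (forall i, der i u = der i v) -> u = v.
Proof.
move=> e; apply: (@emb_inj _ _ _ _ hx); apply/funext => w.
case/lastP: w => [|w i]; first by rewrite !emb_nil.
exact: (congr1 (fun f : A => f w) (e i)).
Qed.

Definition finsupp (f : A) := exists N, forall w, (N < size w)%N -> f w = 0.

Lemma fin_lin (c : K) (f g : A) : finsupp f -> finsupp g -> finsupp (c *: f + g).
Proof.
move=> [N hf] [M hg]; exists (N + M)%N => w hw.
rewrite addsE scalesE hf ?hg ?scaler0 ?addr0 //.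
  by apply: leq_ltn_trans hw; rewrite leq_addl.
by apply: leq_ltn_trans hw; rewrite leq_addr.
Qed.
Lemma fin0 : finsupp 0. Proof. by exists 0%N. Qed.
Lemma finB (f g : A) : finsupp f -> finsupp g -> finsupp (f - g).
Proof. by move=> hf hg; rewrite addrC -scaleN1r; apply: fin_lin. Qed.
Lemma fin1 : finsupp 1. Proof. by exists 0%N; case. Qed.
Lemma finM (f g : A) : finsupp f -> finsupp g -> finsupp (f * g).
Proof.
move=> [N hf] [M hg]; exists (N + M)%N.
elim: N f hf => [|N IH] f hf [//|a w] hw; rewrite muls_cons hg ?mulr0 ?add0r.
- by rewrite (_ : lder a f = 0) ?mul0r //; apply/funext => v; apply: hf.
- exact: hw.
- by apply: IH => // v hv; apply: hf.
- by apply: leq_ltn_trans hw; rewrite leq_addl.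
Qed.

Lemma fin_emb u : finsupp (emb u).
Proof.
elim/(lie_ind hx): u => [|i|c u v hu hv|u v hu hv].
- by rewrite emb0; apply: fin0.
- by rewrite emb_gen; exists 1%N => -[|a [|b w]] // _;
  rewrite /letter eqseq_cons andbF.
- by rewrite embP; apply: fin_lin.
- by rewrite embBr; apply: finB; apply: finM.
Qed.

Lemma fin_der i u : finsupp (der i u).
Proof.
have [N hN] := fin_emb u; exists N => w hw; apply: hN.
by rewrite size_rcons; apply: ltnW.
Qed.

Lemma fin_top (f : A) : finsupp f -> f <> 0 ->
  exists2 u, f u != 0 & forall w, (size u < size w)%N -> f w = 0.
Proof.
case=> N; elim: N => [|N IH] hN f0.
  have [f00|f00] := eqVneq (f [::]) 0; last by exists [::].
  by case: f0; apply/funext => -[|a w]; [apply: f00 | apply: hN].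
have [[w szw fw]|none] := pselect (exists2 w, size w = N.+1 & f w != 0).
  by exists w => // v; rewrite szw; apply: hN.
apply: IH => // w; rewrite leq_eqVlt => /predU1P[szw|/hN//].
by have [//|fw] := eqVneq (f w) 0; case: none; exists w.
Qed.

(** Concatenating longest words of f and g gives a word that occurs in f * g = 1,
    so these words are empty. *)
Lemma fin_unit (f g : A) : finsupp f -> finsupp g -> f * g = 1 ->
  forall w, w != [::] -> g w = 0.
Proof.
move=> hf hg fg w w0.
have one0 := oner_neq0 A.
have [u fu utop] : exists2 u, f u != 0 & forall w, (size u < size w)%N -> f w = 0.
  by apply: fin_top => // f0; move: one0; rewrite -fg f0 mul0r eqxx.
have [v gv vtop] : exists2 u, g u != 0 & forall w, (size u < size w)%N -> g w = 0.
  by apply: fin_top => // g0; move: one0; rewrite -fg g0 mulr0 eqxx.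
have : (f * g) (u ++ v) != 0 by rewrite muls_top // mulf_neq0.
rewrite fg ones_E /nilp size_cat addn_eq0.
case: (size v =P 0%N) => [v0 _|_]; last by rewrite andbF eqxx.
by apply: vtop; rewrite v0 lt0n size_eq0.
Qed.

End FreeCalculus.

(** * Transporting the scalar action and the addition *)

Section TwoVariables.
Variables (K : idomainType) (F : lieAlgType K) (n : nat) (x : 'I_n -> F).
Hypothesis hx : freely_generates x.
Variables i j : 'I_n.
Hypothesis ij : i != j.
Local Notation A := (series 'I_n K^o).
Local Notation emb := (emb hx).
Local Notation letter := (@letter K n).
Local Notation lincoef := (lincoef hx).
Local Notation der := (der hx).

(** Evaluation of Lie polynomials in the two variables x_i and x_j. *)
Definition sub2 (L : lieAlgType K) (a b : L) : {lie F -> L} :=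
  ext hx (fun k => if k == i then a else if k == j then b else 0).

Lemma sub2l L (a b : LieAlgebra.sort L) : sub2 a b (x i) = a.
Proof. by rewrite ext_gen eqxx. Qed.
Lemma sub2r L (a b : LieAlgebra.sort L) : sub2 a b (x j) = b.
Proof. by rewrite ext_gen eq_sym (negPf ij) eqxx. Qed.
Lemma sub2_other L (a b : LieAlgebra.sort L) k :
  k != i -> k != j -> sub2 a b (x k) = 0.
Proof. by move=> ki kj; rewrite ext_gen (negPf ki) (negPf kj). Qed.

Lemma sub2_comp (L : lieAlgType K) (f : {lie F -> L}) a b u :
  f (sub2 a b u) = sub2 (f a) (f b) u.
Proof.
apply: (lie_eq hx (f := lie_comp f (sub2 a b))) => k /=.
have [->|ki] := eqVneq k i; first by rewrite /lie_comp /= !sub2l.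
have [->|kj] := eqVneq k j; first by rewrite /lie_comp /= !sub2r.
by rewrite /lie_comp /= !sub2_other // lie0.
Qed.

Lemma der_sub2_gen k u : k != i -> k != j -> der k (sub2 (x i) (x j) u) = 0.
Proof.
move=> ki kj; elim/(lie_ind hx): u => [|l|c u v hu hv|u v hu hv].
- by rewrite lie0 der0.
- have [->|li] := eqVneq l i; first by rewrite sub2l der_gen (negPf ki).
  have [->|lj] := eqVneq l j; first by rewrite sub2r der_gen (negPf kj).
  by rewrite sub2_other // der0.
- by rewrite lieP derP hu hv scaler0 addr0.
- by rewrite lieBr derBr hu hv !mulr0 subr0.
Qed.

(** The chain rule, in the form that is needed: derivatives satisfy
    der [u, v] = u (der v) - v (der u), so der k (nu u) is a left combination of
    the derivatives of the elements nu (x l). *)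
Lemma der_chain (nu : {lie F -> F}) (d : A) k u :
  (forall l, exists2 g, finsupp g & der k (nu (x l)) = g * d) ->
  exists2 g, finsupp g & der k (nu u) = g * d.
Proof.
move=> hd; elim/(lie_ind hx): u => [|//|c u v [g fg hu] [h fh hv]|u v [g fg hu]
  [h fh hv]].
- by exists 0; [apply: fin0 | rewrite lie0 der0 mul0r].
- exists (c *: g + h); first exact: fin_lin.
  by rewrite lieP derP hu hv mulrDl scalerAl.
- exists (emb (nu u) * h - emb (nu v) * g).
    by apply: finB; apply: finM => //; apply: fin_emb.
  by rewrite lieBr derBr hu hv mulrBl !mulrA.
Qed.
End TwoVariables.

(** Conjugation by s maps endomorphisms to endomorphisms. *)
Definition normalizes (K : comNzRingType) (F : lieAlgType K) (s : F -> F) :=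
  forall nu : {lie F -> F}, exists nu' : {lie F -> F},
    forall a, s (nu a) = nu' (s a).

Section Transport.
Variables (K : idomainType) (F : lieAlgType K) (n : nat) (x : 'I_n -> F).
Hypothesis hx : freely_generates x.
Variables i j : 'I_n.
Hypothesis ij : i != j.
Local Notation A := (series 'I_n K^o).
Local Notation emb := (emb hx).
Local Notation letter := (@letter K n).
Local Notation lincoef := (lincoef hx).
Local Notation der := (der hx).

Variables s t : F -> F.
Hypotheses (st : cancel s t) (ts : cancel t s) (s_norm : normalizes s).

Lemma normalizes0 : s 0 = 0.
Proof.
have [z' hz] := s_norm (ext hx (fun=> 0)).
by have := hz (t 0); rewrite ext0 ts lie0.
Qed.

(** A transported operation again commutes with endomorphisms, so on a free Lie
    algebra its value on generators determines it everywhere. *)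
Lemma normalizes_op (op : F -> F -> F) (nu : {lie F -> F}) a b :
  (forall (f : {lie F -> F}) a b, f (op a b) = op (f a) (f b)) ->
  nu (t (op (s a) (s b))) = t (op (s (nu a)) (s (nu b))).
Proof.
move=> hop; have [nu' hnu] := s_norm nu.
by apply: (can_inj st); rewrite ts hnu ts hop !hnu.
Qed.

(** The element t (c *: s (x i)) is fixed by the endomorphism that keeps x i and
    kills the other generators, whose image is the line through x i. *)
Lemma normalizes_scale : exists psi : K -> K, forall c a, t (c *: s a) = psi c *: a.
Proof.
have hZ c (nu : {lie F -> F}) a : nu (t (c *: s a)) = t (c *: s (nu a)).
  by apply: (@normalizes_op (fun a _ => c *: a) nu a a) => f *; rewrite lieZ.
exists (fun c => lincoef (t (c *: s (x i))) i) => c a.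
have [f fx] : exists f : {lie F -> F}, forall k, f (x k) = (k == i)%:R *: x i.
  by exists (ext hx (fun k => (k == i)%:R *: x i)) => k; rewrite ext_gen.
have q_i : t (c *: s (x i)) = lincoef (t (c *: s (x i))) i *: x i.
  have fi : f (x i) = x i by rewrite fx eqxx scale1r.
  rewrite -[LHS]/(t (c *: s (x i))) -{1}fi -hZ (line_hom hx _ fx).
  rewrite (bigD1 i) //= eqxx mulr1 big1 ?addr0 // => k /negPf ->.
  by rewrite mulr0.
have := hZ c (ext hx (fun=> a)) (x i).
by rewrite ext_gen => <-; rewrite {1}q_i lieZ ext_gen.
Qed.

(** Let w be the left-hand side. In the transported structure psi (-1) *: x j is
    the opposite of x j, so the endomorphism x i |-> w, x j |-> psi (-1) *: x j
    maps w to x i; differentiating, 1 = g * der i w with g of finite support, and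
    der i w is a constant. The same holds for j. The constants are 1 since
    w becomes x i when x j is replaced by 0. *)
Lemma normalizes_add_gen : t (s (x i) + s (x j)) = x i + x j.
Proof.
set w := t _.
have [psi hpsi] := normalizes_scale.
have addH (nu : {lie F -> F}) a b : nu (t (s a + s b)) = t (s (nu a) + s (nu b)).
  by apply: normalizes_op => f *; rewrite lieD.
have w_ij (nu : {lie F -> F}) a b : nu (x i) = a -> nu (x j) = b ->
  nu w = t (s a + s b).
  by move=> <- <-; apply: addH.
have sw : s w = s (x i) + s (x j) by rewrite ts.
have opp a : s (psi (-1) *: a) = - s a by rewrite -hpsi ts scaleN1r.
have der_other k : k != i -> k != j -> der k w = 0.
  move=> ki kj; rewrite -[w](w_ij (sub2 hx i j (x i) (x j))) ?sub2l ?sub2r //.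
  exact: der_sub2_gen.
have const k (nu : {lie F -> F}) : nu w = x k ->
    (forall l, nu (x l) = w \/ der k (nu (x l)) = 0) ->
    forall v, v != [::] -> der k w v = 0.
  move=> nuw nux.
  have [l|g fg] := @der_chain _ _ _ _ hx nu (der k w) k w.
    case: (nux l) => ->; first by exists 1; [apply: fin1 | rewrite mul1r].
    by exists 0; [apply: fin0 | rewrite mul0r].
  rewrite nuw der_gen eqxx => gd.
  by apply: (fin_unit fg (fin_der hx k w)); rewrite -gd.
have der_scaled k l c : k != l -> der k (c *: x l) = 0.
  by move=> kl; rewrite derZ der_gen (negPf kl) scaler0.
have const_i v : v != [::] -> der i w v = 0.
  apply: (const i (sub2 hx i j w (psi (-1) *: x j))).
    by rewrite (w_ij _ _ _ (sub2l _ _ _ _ _) (sub2r _ ij _ _)) sw opp addrK st.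
  move=> l; have [->|li] := eqVneq l i; first by left; rewrite sub2l.
  have [->|lj] := eqVneq l j; first by right; rewrite sub2r // der_scaled.
  by right; rewrite sub2_other // der0.
have const_j v : v != [::] -> der j w v = 0.
  apply: (const j (sub2 hx i j (psi (-1) *: x i) w)).
    rewrite (w_ij _ _ _ (sub2l _ _ _ _ _) (sub2r _ ij _ _)) sw opp addrA.
    by rewrite addNr add0r st.
  move=> l; have [->|li] := eqVneq l i.
    by right; rewrite sub2l der_scaled // eq_sym.
  have [->|lj] := eqVneq l j; first by left; rewrite sub2r.
  by right; rewrite sub2_other // der0.
have lincoef_w k (nu : {lie F -> F}) : nu w = x k -> nu (x k) = x k ->
    (forall l, l != k -> lincoef (nu (x l)) k = 0) -> der k w [::] = 1.
  move=> nuw nuk nul; have := lincoef_comp hx nu w k.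
  rewrite nuw (bigD1 k) //= nuk lincoef_gen eqxx mulr1 big1 ?addr0 // => l /nul ->.
  by rewrite mulr0.
have w_i : der i w [::] = 1.
  apply: (lincoef_w i (sub2 hx i j (x i) 0)); rewrite ?sub2l //.
    by rewrite (w_ij _ _ _ (sub2l _ _ _ _ _) (sub2r _ ij _ _)) normalizes0 addr0 st.
  move=> l li; have [->|lj] := eqVneq l j; first by rewrite sub2r // lincoef0.
  by rewrite sub2_other // lincoef0.
have w_j : der j w [::] = 1.
  apply: (lincoef_w j (sub2 hx i j 0 (x j))); rewrite ?sub2r //.
    by rewrite (w_ij _ _ _ (sub2l _ _ _ _ _) (sub2r _ ij _ _)) normalizes0 add0r st.
  move=> l lj; have [->|li] := eqVneq l i; first by rewrite sub2l lincoef0.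
  by rewrite sub2_other // lincoef0.
have one_at d : d [::] = 1 -> (forall v, v != [::] -> d v = 0) -> d = 1 :> A.
  by move=> d1 d0; apply/funext => -[|a v]; rewrite ?d1 ?d0.
apply: (emb_der_inj (hx := hx)) => k.
rewrite -[x i]scale1r derP !der_gen scale1r.
have [->|ki] := eqVneq k i.
  by rewrite (negPf ij) addr0; apply: one_at.
have [->|kj] := eqVneq k j; first by rewrite add0r; apply: one_at.
by rewrite addr0 der_other.
Qed.

Lemma normalizes_add a b : s (a + b) = s a + s b.
Proof.
apply: (can_inj ts); rewrite st.
pose nu := sub2 hx i j a b.
have := @normalizes_op (fun a b => a + b) nu (x i) (x j) (fun f => @lieD _ _ _ f).
by rewrite normalizes_add_gen lieD /nu sub2l sub2r.
Qed.

End Transport.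

(** * Three independent variables inside two-generated algebras *)

Section RowZero.
Variables (K : idomainType) (X : Type).
Local Notation A := (series X K^o).
Local Notation A3 := (series X 'M[K]_3).

Definition entry (f : A3) k l : A := fun w => f w k l.

(** The top row of p.1 is (q.1, 0, 0), and the top entry of the vector p.2, kept
    as a first column, is q.2. Affine maps of this kind are closed under the
    bracket, and reading off the top row is a Lie homomorphism on them. *)
Definition toprow (p : affine A3) (q : affine A) :=
  (forall w k, p.1 w 0 k = q.1 w * (k == 0)%:R) /\ (forall w, p.2 w 0 0 = q.2 w).

Lemma mul_toprow (f g : A3) (f' : A) :
  (forall w k, f w 0 k = f' w * (k == 0)%:R) ->
  forall w k, (f * g) w 0 k = (f' * entry g 0 k) w.
Proof.
move=> h w; elim: w f f' h => [|a w IH] f f' h k.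
  rewrite !muls_nil mxE (bigD1 0) //= h eqxx mulr1 big1 ?addr0 // => l /negPf l0.
  by rewrite h l0 mulr0 mul0r.
rewrite !muls_cons [LHS]mxE; congr (_ + _); last by apply: IH => v l; apply: h.
rewrite mxE (bigD1 0) //= h eqxx mulr1 big1 ?addr0 // => l /negPf l0.
by rewrite h l0 mulr0 mul0r.
Qed.

Lemma toprow0 : toprow 0 0.
Proof. by split=> [w k|w]; rewrite ?mxE /= ?mul0r. Qed.

Lemma toprowP c p p' q q' : toprow p q -> toprow p' q' ->
  toprow (c *: p + p') (c *: q + q').
Proof.
move=> [h1 h2] [h1' h2']; split=> [w k|w]; rewrite /= !addsE !scalesE !mxE.
  by rewrite h1 h1' mulrDl mulrA.
by rewrite h2 h2'.
Qed.

Lemma toprow_br p p' q q' : toprow p q -> toprow p' q' ->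
  toprow (bracket p p') (bracket q q').
Proof.
move=> [h1 h2] [h1' h2']; split=> [w k|w]; rewrite /= !addsE !oppsE !mxE.
  have entryE (r : affine A3) (o : affine A) : (forall w k, r.1 w 0 k = o.1 w *
    (k == 0)%:R) ->
      entry r.1 0 k = ((k == 0)%:R : K) *: o.1.
    by move=> h; apply/funext => v; rewrite scalesE /entry h mulrC.
  rewrite (mul_toprow _ h1) (mul_toprow _ h1') (entryE _ _ h1) (entryE _ _ h1').
  by rewrite -!scalerAr !scalesE mulrBl ![_ * (k == 0)%:R]mulrC.
rewrite (mul_toprow _ h1) (mul_toprow _ h1').
have -> : entry p.2 0 0 = q.2 by apply/funext.
by have -> : entry p'.2 0 0 = q'.2 by apply/funext.
Qed.

Lemma toprow_inj p q q' : toprow p q -> toprow p q' -> q = q'.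
Proof.
move=> [h1 h2] [h1' h2']; case: q q' h1 h2 h1' h2' =>
  [a b] [a' b'] /= h1 h2 h1' h2'.
congr (_, _); apply/funext => w; last by rewrite -h2 h2'.
by have := h1 w 0; rewrite h1' eqxx !mulr1.
Qed.

Definition cst (m : 'M[K]_3) : A3 := fun w => if w is [::] then m else 0.

Lemma mul_cstl m (f : A3) w : (cst m * f) w = m * f w.
Proof.
rewrite (@muls_homogl _ _ _ _ _ 0%N) /= ?take0 ?drop0 //.
by case.
Qed.

Lemma mul_cstr m (f : A3) w : (f * cst m) w = f w * m.
Proof.
elim: w f => [|a w IH] f //.
by rewrite muls_cons IH mulr0 add0r.
Qed.

Definition shift3 : 'M[K]_3 := \matrix_(k, l) (l == k.+1 :> nat)%:R.

Lemma shift3_l0 (m : 'M[K]_3) l : (shift3 * m) 0 l = m 1 l.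
Proof.
rewrite mxE !big_ord_recl big_ord0 !mxE /= !mul0r mul1r add0r !addr0.
by congr (m _ _); apply: val_inj.
Qed.
Lemma shift3_l1 (m : 'M[K]_3) l : (shift3 * m) 1 l = m 2 l.
Proof.
rewrite mxE !big_ord_recl big_ord0 !mxE /= !mul0r mul1r !add0r !addr0.
by congr (m _ _); apply: val_inj.
Qed.
Lemma shift3_r0 (m : 'M[K]_3) k : (m * shift3) k 0 = 0.
Proof.
by rewrite mxE !big_ord_recl big_ord0 !mxE /= !mulr0 !addr0.
Qed.
Lemma shift3_r1 (m : 'M[K]_3) k : (m * shift3) k 1 = m k 0.
Proof.
by rewrite mxE !big_ord_recl big_ord0 !mxE /= !mulr0 mulr1 !addr0.
Qed.
Lemma shift3_r2 (m : 'M[K]_3) k : (m * shift3) k 2 = m k 1.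
Proof.
rewrite mxE !big_ord_recl big_ord0 !mxE /= !mulr0 mulr1 add0r !addr0.
by congr (m _ _); apply: val_inj.
Qed.

Definition ad3 (m : 'M[K]_3) : 'M[K]_3 := shift3 * m - m * shift3.

Lemma ad3E m :
  (ad3 m 0 0 = m 1 0) * (ad3 m 0 1 = m 1 1 - m 0 0) *
  (ad3 m 0 2 = m 1 2 - m 0 1) * (ad3 m 1 0 = m 2 0) *
  (ad3 m 1 1 = m 2 1 - m 1 0) * (ad3 m 1 2 = m 2 2 - m 1 1).
Proof.
have subE (a b : 'M[K]_3) k l : (a - b) k l = a k l - b k l by rewrite !mxE.
rewrite /ad3 !subE !shift3_l0 !shift3_l1 !shift3_r0 !shift3_r1 !shift3_r2.
by rewrite !subr0.
Qed.

(** With Y = shift3, taking the commutator with Y moves the entries of these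
    matrices one row up, so the first column of [tri3 q], namely q 0, q 1, q 2,
    gives the top left entries of its iterated commutators with Y. The other
    entries, k%:R * q 1 in particular, are chosen to cancel the rest of the top
    row in any characteristic. *)
Definition tri3 (q : 'I_3 -> A) : A3 := fun w => \matrix_(k, l)
  if l == k then q 0 w else
  if k == l.+1 :> nat then k%:R * q 1 w else
  if k == l.+2 :> nat then q 2 w else 0.
Definition col3 (q : 'I_3 -> A) : A3 := fun w => \matrix_(k, l)
  if l == 0 then q k w else 0.

Lemma ord3P (P : 'I_3 -> Prop) : P 0 -> P 1 -> P 2 -> forall k, P k.
Proof.
move=> P0 P1 P2 [[|[|[|//]]] lt].
- by rewrite (_ : Ordinal lt = 0) //; apply: val_inj.
- by rewrite (_ : Ordinal lt = 1) //; apply: val_inj.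
- by rewrite (_ : Ordinal lt = 2) //; apply: val_inj.
Qed.

Lemma toprow_tri3 (q : 'I_3 -> affine A) :
  let Y : affine A3 := (cst shift3, 0) in
  let T : affine A3 := (tri3 (fun k => (q k).1), col3 (fun k => (q k).2)) in
  [/\ toprow T (q 0), toprow (bracket Y T) (q 1) &
      toprow (bracket Y (bracket Y T)) (q 2)].
Proof.
move=> Y T.
have br1 (Z : affine A3) w : (bracket Y Z).1 w = ad3 (Z.1 w).
  by rewrite affine_br1 addsE oppsE mul_cstl mul_cstr.
have br2 (Z : affine A3) w : (bracket Y Z).2 w = shift3 * Z.2 w.
  by rewrite affine_br2 /= mulr0 subr0 mul_cstl.
split; split=> [w k|w].
- by elim/ord3P: k; rewrite !mxE /= ?mulr1 ?mulr0.
- by rewrite mxE.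
- rewrite br1; elim/ord3P: k; rewrite ad3E !mxE /= ?mul1r ?mulr1 ?mulr0 //.
  + by rewrite subrr.
  + by rewrite subrr.
- by rewrite br2 shift3_l0 mxE.
- rewrite br1 br1; elim/ord3P: k; rewrite ad3E !ad3E !mxE /= ?mulr1 ?mulr0 //.
  + by rewrite mul1r mulr2n mulrDl mul1r addrK subrr.
  + by rewrite !subrr.
- by rewrite br2 shift3_l0 br2 shift3_l1 mxE.
Qed.

End RowZero.

(** * Bilinear alternating Lie polynomials *)

Section Bilinear.
Variables (K : idomainType) (F : lieAlgType K) (n : nat) (x : 'I_n -> F).
Hypothesis hx : freely_generates x.
Variables i j : 'I_n.
Hypothesis ij : i != j.
Local Notation A := (series 'I_n K^o).
Local Notation emb := (emb hx).
Local Notation letter := (@letter K n).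
Local Notation der := (der hx).
Local Notation sub2 := (sub2 hx i j).
Local Notation aff a b := ((a : A, b : A) : affine A).
Implicit Types (p u : F) (q : affine A).

Lemma sub2_toprow (f : {lie F -> affine (series 'I_n 'M[K]_3)}) a b q q' u :
  toprow (f a) q -> toprow (f b) q' -> toprow (f (sub2 a b u)) (sub2 q q' u).
Proof.
move=> ha hb; elim/(lie_ind hx): u => [|k|c u v hu hv|u v hu hv].
- by rewrite !lie0; apply: toprow0.
- have [->|ki] := eqVneq k i; first by rewrite !sub2l.
  have [->|kj] := eqVneq k j; first by rewrite !sub2r.
  by rewrite !sub2_other // lie0; apply: toprow0.
- by rewrite !lieP; apply: toprowP.
- by rewrite !lieBr; apply: toprow_br.
Qed.

(** The elements x i, [x j, x i], [x j, [x j, x i]] can be sent to any three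
    prescribed top rows, as if they were three free generators. *)
Lemma realize3 q0 q1 q2 : exists f : {lie F -> affine (series 'I_n 'M[K]_3)},
  exists a0 a1 a2, [/\ toprow (f a0) q0, toprow (f a1) q1 & toprow (f a2) q2].
Proof.
pose q (k : 'I_3) := if k == 0 then q0 else if k == 1 then q1 else q2 : affine A.
have [h0 h1 h2] := toprow_tri3 q.
set Y := (cst (shift3 K), 0) in h1 h2; set T := (tri3 _, _) in h0 h1 h2.
exists (sub2 (T : affine _) Y), (x i), (bracket (x j) (x i)),
  (bracket (x j) (bracket (x j) (x i))).
by rewrite !lieBr sub2l sub2r.
Qed.

(** Additivity of p on F, used for the three elements above, thus becomes
    additivity for arbitrary arguments in affine A. *)
Lemma sub2_linear_affine p q0 q1 q2 :
  (forall a a' b : F, sub2 (a + a') b p = sub2 a b p + sub2 a' b p) ->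
  sub2 (q0 + q1) q2 p = sub2 q0 q2 p + sub2 q1 q2 p.
Proof.
move=> addp; have [f [a0 [a1 [a2 [h0 h1 h2]]]]] := realize3 q0 q1 q2.
have toprowD P P' Q Q' : toprow P Q -> toprow P' Q' -> toprow (P + P') (Q + Q').
  by move=> h h'; have := toprowP 1 h h'; rewrite !scale1r.
have h01 : toprow (f (a0 + a1)) (q0 + q1) by rewrite lieD; apply: toprowD.
apply: toprow_inj (sub2_toprow p h01 h2) _.
by rewrite addp lieD; apply: toprowD; apply: sub2_toprow.
Qed.

Definition letter_sum (S : pred 'I_n) : A :=
  fun w => if w is [:: a] then (S a)%:R else 0.

Lemma letter_sum1 k : letter_sum (pred1 k) = letter k.
Proof.
by apply/funext => -[|a [|b w]]; rewrite /letter //= eqseq_cons ?andbT ?andbF.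
Qed.

Lemma letter_sum2 : letter_sum (pred2 i j) = letter i + letter j.
Proof.
apply/funext => w; rewrite addsE -!letter_sum1; case: w => [|a [|b w]] /=.
- by rewrite addr0.
- have [->|ai] := eqVneq a i; first by rewrite (negPf ij) addr0.
  by rewrite add0r.
- by rewrite addr0.
Qed.

Lemma mul_letter_sum S (f : A) w : (letter_sum S * f) w =
  if w is a :: v then (S a)%:R * f v else 0.
Proof.
case: w => [|a v]; first by rewrite muls_nil mul0r.
rewrite muls_cons mul0r add0r (@muls_homogl _ _ _ _ _ 0%N) //=.
  by rewrite take0 drop0.
by case.
Qed.

(** The part of u that is linear in the first variable is g(ad y) applied to that
    variable, with one polynomial g for all values y of the second variable. On
    y = letter_sum S the coefficient of w in g(y) is that of y ^+ size w. *)
Lemma sub2_first_linear u : exists (c : K) (g : nat -> K), forall S,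
  sub2 (aff 0 1) (aff (letter_sum S) 0) u =
  (c *: letter_sum S, fun w => g (size w) * (all S w)%:R) :> affine A.
Proof.
elim/(lie_ind hx): u => [|k|c u v [cu [gu hu]] [cv [gv hv]]|
                         u v [cu [gu hu]] [cv [gv hv]]].
- exists 0, (fun=> 0) => S; rewrite lie0 scale0r; congr (_, _).
  by apply/funext => w; rewrite mul0r.
- have [->|ki] := eqVneq k i.
    exists 0, (fun m => (m == 0%N)%:R) => S; rewrite sub2l scale0r; congr (_, _).
    by apply/funext => -[|a w]; rewrite ones_E /= ?mulr1 ?mul0r.
  have [->|kj] := eqVneq k j.
    exists 1, (fun=> 0) => S; rewrite sub2r // scale1r; congr (_, _).
    by apply/funext => w; rewrite mul0r.
  exists 0, (fun=> 0) => S; rewrite sub2_other // scale0r; congr (_, _).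
  by apply/funext => w; rewrite mul0r.
- exists (c * cu + cv), (fun m => c * gu m + gv m) => S; rewrite lieP hu hv.
  congr (_, _) => /=; first by rewrite scalerDl scalerA.
  by apply/funext => w; rewrite addsE scalesE mulrDl; congr (_ + _); apply: mulrA.
- exists 0, (fun m => if m is m'.+1 then cu * gv m' - cv * gu m' else 0) => S.
  rewrite lieBr hu hv; congr (_, _) => /=.
    by rewrite scale0r -!scalerAl -!scalerAr !scalerA mulrC subrr.
  apply/funext => w; rewrite -!scalerAl addsE oppsE !scalesE !mul_letter_sum.
  case: w => [|a w] /=; first by rewrite !scaler0 subr0 mul0r.
  have sc (k l m r : K) : k * (l * (m * r)) = k * m * (l * r).
    by rewrite mulrA mulrACA.
  by rewrite -mulnb natrM mulrBl; congr (_ - _); apply: sc.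
Qed.

(** Evaluating with second components 1 at x k and 0 elsewhere computes the
    derivative. *)
Lemma sub2_der k u : k = i \/ k = j ->
  sub2 (aff (letter i) (k == i)%:R) (aff (letter j) (k == j)%:R) u =
  (emb (sub2 (x i) (x j) u), der k (sub2 (x i) (x j) u)) :> affine A.
Proof.
move=> hk; elim/(lie_ind hx): u => [|l|c u v hu hv|u v hu hv].
- by rewrite !lie0 emb0 der0.
- have [->|li] := eqVneq l i; first by rewrite !sub2l emb_gen der_gen.
  have [->|lj] := eqVneq l j; first by rewrite !sub2r // emb_gen der_gen.
  by rewrite !sub2_other // emb0 der0.
- by rewrite !lieP hu hv embP derP.
- by rewrite !lieBr hu hv embBr derBr.
Qed.

Lemma sub2_0 (a b : A) u : (sub2 (aff a 0) (aff b 0) u).2 = 0.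
Proof.
elim/(lie_ind hx): u => [|l|c u v hu hv|u v hu hv].
- by rewrite lie0.
- have [->|li] := eqVneq l i; first by rewrite sub2l.
  have [->|lj] := eqVneq l j; first by rewrite sub2r.
  by rewrite sub2_other.
- by rewrite lieP /= hu hv scaler0 addr0.
- by rewrite lieBr affine_br2 hu hv !mulr0 subr0.
Qed.

(** By additivity der i p only sees the part of p that is linear in x i, so it is
    g(x j) for a polynomial g, and der j p = - g(x i) by alternation. Additivity
    in the second variable gives g(x i + x j) = g(x i) + g(x j) with
    noncommuting x i and x j, which leaves only the linear term of g. *)
Lemma bilinear_alternating p :
  sub2 (x i) (x j) p = p ->
  (forall a a' b : F, sub2 (a + a') b p = sub2 a b p + sub2 a' b p) ->
  sub2 (x j) (x i) p = - p ->
  exists c : K, p = c *: bracket (x i) (x j).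
Proof.
move=> fixp addp altp.
have alt (q q' : affine A) : sub2 q' q p = - sub2 q q' p.
  have := sub2_comp hx ij (sub2 q q') (x j) (x i) p.
  by rewrite sub2l sub2r // altp lieN => ->.
have add := fun q0 q1 q2 => sub2_linear_affine q0 q1 q2 addp.
have [c [g hg]] := sub2_first_linear p.
pose G S : A := fun w => g (size w) * (all S w)%:R.
have pairD (a b : A) : (a, b) = (0, b) + (a, 0) :> affine A.
  by congr (_, _) => /=; rewrite ?add0r ?addr0.
have der_i : der i p = G (pred1 j).
  have := sub2_der p (or_introl (erefl i)); rewrite eqxx (negPf ij) fixp.
  rewrite (pairD (letter i)) add -letter_sum1 hg.
  move/(congr1 snd) => /= <-.
  by rewrite sub2_0 addr0.
have der_j : der j p = - G (pred1 i).
  have := sub2_der p (or_intror (erefl j)); rewrite eqxx eq_sym (negPf ij) fixp.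
  rewrite alt (pairD (letter j)) add -letter_sum1 hg.
  move/(congr1 snd) => /= <-.
  by rewrite sub2_0 addr0.
have G2 : G (pred2 i j) = G (pred1 i) + G (pred1 j).
  have sE S : (sub2 (aff 0 1) (aff (letter_sum S) 0) p).2 = G S by rewrite hg.
  rewrite -!sE letter_sum2 !letter_sum1.
  have -> : (letter i + letter j, 0) = (letter i, 0) + (letter j, 0) :> affine A.
    by congr (_, _) => /=; rewrite addr0.
  by rewrite alt add (alt (aff (letter i) 0)) (alt (aff (letter j) 0)) opprD.
have g0 k : k != 1%N -> g k = 0.
  (* for k >= 2 the word i j ... j occurs in (x i + x j) ^+ k only *)
  case: k => [|[//|k]] _.
    have := congr1 (fun f : A => f [::]) G2.
    by rewrite addsE /G /= mulr1 => /eqP;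
      rewrite -subr_eq0 opprD addrA subrr sub0r oppr_eq0 => /eqP.
  have := congr1 (fun f : A => f (i :: nseq k.+1 j)) G2.
  rewrite addsE /G /= size_nseq !eqxx orbT /= (eq_sym j i) (negPf ij) !mulr0 addr0.
  by rewrite all_nseq /= !eqxx !orbT mulr1.
have GE k : G (pred1 k) = g 1%N *: letter k.
  apply/funext => w; rewrite scalesE /G /letter.
  have [/eqP|w1] := eqVneq (size w) 1%N.
    by case: w => [//|a [|//]] _; rewrite /= eqseq_cons !andbT.
  rewrite g0 // mul0r; case: eqP => [E|_]; last by rewrite scaler0.
  by rewrite E in w1.
exists (- g 1%N); apply: (emb_der_inj (hx := hx)) => k.
rewrite derZ derBr !der_gen !emb_gen.
have [->|ki] := eqVneq k i.
  by rewrite (negPf ij) mulr0 sub0r mulr1 scaleNr scalerN opprK -GE.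
have [->|kj] := eqVneq k j.
  by rewrite mulr0 subr0 mulr1 scaleNr -GE.
by rewrite !mulr0 subr0 scaler0 -fixp der_sub2_gen.
Qed.

End Bilinear.

(** * An adjoint bijection from the rank one property *)

Section QuasiInner.
Variables (K : idomainType) (F : lieAlgType K) (n : nat) (x : 'I_n -> F).
Hypotheses (hK : R1MF K) (hx : freely_generates x).
Variable i : 'I_n.
Local Notation A := (series 'I_n K^o).
Local Notation emb := (emb hx).
Local Notation lincoef := (lincoef hx).
Local Notation End := {lie F -> F}.

Lemma end_eq (f g : End) : (forall k, f (x k) = g (x k)) -> f = g.
Proof. by move=> fg; apply/lie_morphism_ext/(lie_eq hx). Qed.

Lemma lincoef_sum (c : 'I_n -> K) l : lincoef (\sum_k c k *: x k) l = c l.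
Proof.
have sumE (r : seq 'I_n) :
    lincoef (\sum_(k <- r) c k *: x k) l = \sum_(k <- r) c k * (k == l)%:R.
  elim: r => [|k r IH]; first by rewrite !big_nil lincoef0.
  by rewrite !big_cons lincoefP IH lincoef_gen.
rewrite sumE (bigD1 l) //= eqxx mulr1 big1 ?addr0 // => k /negPf ->.
by rewrite mulr0.
Qed.

Definition order_ge m (f : A) := forall w, (size w < m)%N -> f w = 0.

Lemma order_ge_mul a b (f g : A) :
  order_ge a f -> order_ge b g -> order_ge (a + b) (f * g).
Proof.
move=> hf hg w; elim: w a f hf => [|k w IH] a f hf hw.
  rewrite muls_nil; case: a hf hw => [_ hw|a hf _]; first by rewrite hg ?mulr0.
  by rewrite hf ?mul0r.
rewrite muls_cons; case: a hf hw => [|a] hf hw.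
  by rewrite hg // mulr0 add0r (IH 0%N) // ltnW.
by rewrite hf // mul0r add0r (IH a) // => v hv; apply: hf.
Qed.

Lemma order_ge_lin m c (f g : A) :
  order_ge m f -> order_ge m g -> order_ge m (c *: f + g).
Proof.
by move=> hf hg w hw; rewrite addsE scalesE hf ?hg // scaler0 addr0.
Qed.

Lemma order_geW m m' (f : A) : (m <= m')%N -> order_ge m' f -> order_ge m f.
Proof. by move=> le h w hw; apply: h; apply: leq_trans hw le. Qed.

Lemma order_ge_br m u v : order_ge m (emb u) -> order_ge m (emb v) ->
  order_ge (m + m) (emb (bracket u v)).
Proof.
move=> hu hv; rewrite embBr addrC -scaleN1r.
by apply: order_ge_lin; apply: order_ge_mul.
Qed.

Definition nonlinear u := u - \sum_k lincoef u k *: x k.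

Lemma nonlinearP c u v : nonlinear (c *: u + v) = c *: nonlinear u + nonlinear v.
Proof.
rewrite /nonlinear scalerBr addrACA -opprD; congr (_ - _).
rewrite scaler_sumr -big_split; apply: eq_bigr => k _ /=.
by rewrite lincoefP scalerDl scalerA.
Qed.

Lemma nonlinear_id u : (forall k, lincoef u k = 0) -> nonlinear u = u.
Proof.
by move=> h; rewrite /nonlinear big1 ?subr0 // => k _; rewrite h scale0r.
Qed.

(** If all e u have order >= m then, for a v without linear part, e v is a
    combination of brackets of such elements and has order > m. Applied to
    v = e (x k) = e v, this raises the order of e without end. *)
Lemma idempotent_eq0 (e : End) : (forall u, e (e u) = e u) ->
  (forall k l, lincoef (e (x k)) l = 0) -> forall u, e u = 0.
Proof.
move=> ee e0 u; apply: (emb_inj0 (hx := hx)); apply/funext => w.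
suff: forall m u, order_ge m (emb (e u)) by move=> /(_ (size w).+1 u); apply.
elim=> [//|[|m] IH] {w}u; first by case=> // _; rewrite emb_nil.
have rest v : order_ge m.+2 (emb (e (nonlinear v))).
  elim/(lie_ind hx): v => [|k|c v v' hv hv'|v v' _ _].
  - rewrite nonlinear_id; last by move=> k; rewrite lincoef0.
    by rewrite lie0 emb0.
  - rewrite /nonlinear (bigD1 k) //= lincoef_gen eqxx scale1r big1 ?addr0.
      by rewrite subrr lie0 emb0.
    by move=> l lk; rewrite lincoef_gen eq_sym (negPf lk) scale0r.
  - by rewrite nonlinearP lieP embP; apply: order_ge_lin.
  - rewrite nonlinear_id; last by move=> k; rewrite lincoef_br.
    rewrite lieBr; apply: order_geW (order_ge_br (IH _) (IH _)).
    by rewrite !addnS !addSn !ltnS leq_addl.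
elim/(lie_ind hx): u => [|k|c v v' hv hv'|v v' hv hv'].
- by rewrite lie0 emb0.
- by have := rest (e (x k)); rewrite nonlinear_id ?ee.
- by rewrite lieP embP; apply: order_ge_lin.
- by rewrite lieBr; apply: order_geW (order_ge_br hv hv'); rewrite leq_addl.
Qed.

Definition zero_end : End := ext hx (fun=> 0).
Definition const_end (a : F) : End := ext hx (fun=> a).

Lemma const_endE a u : const_end a u = (\sum_k lincoef u k) *: a.
Proof.
rewrite (@line_hom _ _ _ _ hx _ _ (fun=> 1) a).
  by congr (_ *: _); apply: eq_bigr => k _; rewrite mulr1.
by move=> k; rewrite ext_gen scale1r.
Qed.

Variables Phi Psi : End -> End.
Hypotheses (PhiK : cancel Phi Psi) (PsiK : cancel Psi Phi).
Hypothesis PhiM : forall f g, Phi (lie_comp f g) = lie_comp (Phi f) (Phi g).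

Lemma PsiM f g : Psi (lie_comp f g) = lie_comp (Psi f) (Psi g).
Proof. by apply: (can_inj PhiK); rewrite PhiM !PsiK. Qed.

Lemma Phi_zero : Phi zero_end = zero_end.
Proof.
have -> : zero_end = lie_comp zero_end (Psi zero_end).
  by apply: end_eq => k; rewrite /lie_comp /= !ext0.
rewrite PhiM PsiK; apply: end_eq => k.
by rewrite /lie_comp /= !ext0 lie0.
Qed.

Definition eps := const_end (x i).
Definition Phi_eps := Phi eps.
Definition Phi_eps_mx k l := lincoef (Phi_eps (x k)) l.

Lemma eps_gen k : eps (x k) = x i. Proof. by rewrite ext_gen. Qed.

Lemma eps_idem : lie_comp eps eps = eps.
Proof. by apply: end_eq => k; rewrite /lie_comp /= !eps_gen. Qed.

Lemma Phi_eps_idem u : Phi_eps (Phi_eps u) = Phi_eps u.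
Proof.
have -> : Phi_eps (Phi_eps u) = lie_comp Phi_eps Phi_eps u by [].
by rewrite -PhiM eps_idem.
Qed.

(** The maps eps o a o eps are multiplications by scalars on a line, so they
    commute; Phi transfers this to Phi_eps. *)
Lemma Phi_eps_comm (a b : End) u : Phi_eps (a (Phi_eps (b (Phi_eps u)))) =
  Phi_eps (b (Phi_eps (a (Phi_eps u)))).
Proof.
pose tri (f g h : End) := lie_comp f (lie_comp g (lie_comp f (lie_comp h f))).
have triE f g h : Phi (tri f g h) = tri (Phi f) (Phi g) (Phi h).
  by rewrite /tri !PhiM.
rewrite -[LHS]/(tri Phi_eps a b u) -[RHS]/(tri Phi_eps b a u).
rewrite -(PsiK a) -(PsiK b) -!triE; congr (Phi _ u); apply: end_eq => k.
rewrite /tri /lie_comp /= eps_gen.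
have epsE u' : eps u' = (\sum_l lincoef u' l) *: x i := const_endE _ _.
by rewrite (epsE (Psi b (x i))) (epsE (Psi a (x i))) !lieZ !epsE !scalerA mulrC.
Qed.

Definition elem_end r l : End := ext hx (fun k => (k == r)%:R *: x l).

Lemma elem_endE r l u : elem_end r l u = lincoef u r *: x l.
Proof.
rewrite (@line_hom _ _ _ _ hx _ _ (fun k => (k == r)%:R) (x l)); last first.
  by move=> k; rewrite ext_gen.
congr (_ *: _); rewrite (bigD1 r) //= eqxx mulr1 big1 ?addr0 // => k /negPf ->.
by rewrite mulr0.
Qed.

(** Take for a and b in [Phi_eps_comm] the elementary endomorphisms x k |-> x s and
    x k |-> x j. *)
Lemma Phi_eps_mx_minor j k s q : Phi_eps_mx j k != 0 ->
  Phi_eps_mx j k * Phi_eps_mx s q = Phi_eps_mx s k * Phi_eps_mx j q.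
Proof.
move=> jk0; have := Phi_eps_comm (elem_end k s) (elem_end k j) (x j).
rewrite !(elem_endE _ _ (Phi_eps (x j))) !lieZ !elem_endE !lieZ !scalerA.
move/(congr1 (fun u => lincoef u q)); rewrite !lincoefZ -!/(Phi_eps_mx _ _).
by rewrite -!mulrA => /(mulfI jk0).
Qed.

Lemma Phi_eps_mx_neq0 : exists j k, Phi_eps_mx j k != 0.
Proof.
apply: contrapT => none.
have e0 u : Phi_eps u = 0.
  apply: idempotent_eq0 => [|j k]; first exact: Phi_eps_idem.
  by apply/eqP; apply: contrapT => /negP h; apply: none; exists j, k.
have : eps = zero_end.
  apply: (can_inj PhiK); rewrite Phi_zero; apply: end_eq => k.
  by rewrite ext0; apply: e0.
move/(congr1 (fun f : End => lincoef (f (x i)) i)).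
rewrite eps_gen ext0 lincoef_gen eqxx lincoef0 => /eqP.
by rewrite oner_eq0.
Qed.

(** Over the fraction field the matrix of Phi_eps has rank one by
    [Phi_eps_mx_minor]; the normalization of the factors is the idempotence of
    Phi_eps. *)
Lemma Phi_eps_mx_factor : exists u v : 'I_n -> K,
  (forall k l, Phi_eps_mx k l = u k * v l) /\ \sum_k v k * u k = 1.
Proof.
have [j [k jk0]] := Phi_eps_mx_neq0.
pose M := \matrix_(k, l) Phi_eps_mx k l.
have rM : \rank (map_mx (@tofrac K) M) = 1%N.
  apply/eqP; rewrite eqn_leq lt0n mxrank_eq0; apply/andP; split; last first.
    apply/eqP => /matrixP /(_ j k); rewrite !mxE => /eqP.
    by rewrite tofrac_eq0 (negPf jk0).
  have -> : map_mx (@tofrac K) M =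
      (\col_s (tofrac (Phi_eps_mx s k) / tofrac (Phi_eps_mx j k))) *m
      (\row_q tofrac (Phi_eps_mx j q)).
    apply/matrixP => s q; rewrite !mxE big_ord1 !mxE.
    rewrite mulrAC -rmorphM -Phi_eps_mx_minor // rmorphM mulrAC divff ?mul1r //.
    by rewrite tofrac_eq0.
  exact: mulmx_max_rank.
have [u [v Muv]] := hK rM.
have ME k' l : Phi_eps_mx k' l = u k' 0 * v 0 l.
  by have := congr1 (fun N : 'M_n => N k' l) Muv; rewrite !mxE big_ord1.
exists (fun k => u k 0), (fun l => v 0 l); split=> //.
have sq : \sum_l Phi_eps_mx j l * Phi_eps_mx l k = Phi_eps_mx j k.
  by rewrite /Phi_eps_mx -lincoef_comp Phi_eps_idem.
apply: (mulfI jk0); rewrite mulr1 -[RHS]sq mulr_sumr; apply: eq_bigr => l _.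
rewrite !ME; ring.
Qed.

Definition line_end (u : 'I_n -> K) (a : F) : End := ext hx (fun k => u k *: a).

Lemma line_endE u a b : line_end u a b = (\sum_k lincoef b k * u k) *: a.
Proof. by apply: (line_hom hx) => k; rewrite ext_gen. Qed.

(** The right-hand side f is an idempotent with Phi_eps f = f Phi_eps = f. Its
    preimage g satisfies eps g = g eps = g, so g acts on the line through x i by
    an idempotent scalar, which is 0 or 1. *)
Lemma Phi_eps_rank_one : exists (u : 'I_n -> K) (W : F),
  Phi_eps = line_end u W /\ \sum_k lincoef W k * u k = 1.
Proof.
have [u [v [uv vu]]] := Phi_eps_mx_factor.
pose W := Phi_eps (\sum_k v k *: x k).
have cW l : lincoef W l = v l.
  rewrite lincoef_comp -[RHS]mul1r -vu mulr_suml; apply: eq_bigr => k _.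
  by rewrite lincoef_sum -/(Phi_eps_mx k l) uv mulrA.
have W1 : \sum_k lincoef W k * u k = 1.
  by rewrite -[RHS]vu; apply: eq_bigr => k _; rewrite cW.
exists u, W; split=> //; pose f := line_end u W.
have fW : f W = W by rewrite line_endE W1 scale1r.
have eW : Phi_eps W = W by apply: Phi_eps_idem.
have fgen k : f (x k) = u k *: W by rewrite ext_gen.
have ef : lie_comp Phi_eps f = f.
  by apply: end_eq => k; rewrite /lie_comp /= fgen lieZ eW.
have fe : lie_comp f Phi_eps = f.
  apply: end_eq => k; rewrite /lie_comp /= fgen line_endE; congr (_ *: _).
  rewrite -[RHS]mulr1 -vu mulr_sumr; apply: eq_bigr => l _.
  by rewrite -/(Phi_eps_mx k l) uv mulrA.
have ff : lie_comp f f = f.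
  by apply: end_eq => k; rewrite /lie_comp /= fgen lieZ fW.
have Psi_e : Psi Phi_eps = eps by rewrite /Phi_eps PhiK.
pose g := Psi f.
have gg a : g (g a) = g a by rewrite -[LHS]/(lie_comp g g a) -PsiM ff.
have eg a : eps (g a) = g a.
  by rewrite -[LHS]/(lie_comp eps g a) -Psi_e -PsiM ef.
have ge a : g (eps a) = g a.
  by rewrite -[LHS]/(lie_comp g eps a) -Psi_e -PsiM fe.
have [c gc] : exists c, g (x i) = c *: x i.
  by exists (\sum_k lincoef (g (x i)) k); rewrite -{1}eg const_endE.
have ggen k : g (x k) = c *: x i by rewrite -ge eps_gen.
have cc : c * c = c.
  have := congr1 (fun a => lincoef a i) (gg (x i)).
  by rewrite /= !(gc, lieZ) !lincoefZ lincoef_gen eqxx !mulr1.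
have [c0|c0] := eqVneq c 0.
  have g0 : g = zero_end.
    by apply: end_eq => k; rewrite ggen c0 scale0r ext0.
  have : W = 0 by rewrite -fW -[f]PsiK -/g g0 Phi_zero ext0.
  move=> W0; have := W1; rewrite big1 => [/eqP|k _].
    by rewrite eq_sym oner_eq0.
  by rewrite W0 lincoef0 mul0r.
have c1 : c = 1 by apply: (mulfI c0); rewrite mulr1.
rewrite -[RHS]PsiK -/f -/g /Phi_eps; congr Phi; apply: end_eq => k.
by rewrite ggen c1 scale1r eps_gen.
Qed.

(** Endomorphisms nu with nu eps = nu correspond to elements of F by their
    common value on the generators, and those with nu Phi_eps = nu by their value at
    W; Phi is a bijection between the two sets. *)
Lemma quasi_inner_adjoint : exists s t : F -> F, [/\ cancel s t, cancel t s &
  forall (nu : End) a, s (nu a) = Phi nu (s a)].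
Proof.
have [u [W [eE W1]]] := Phi_eps_rank_one.
pose s a := Phi (const_end a) W.
pose t b := Psi (line_end u b) (x i).
have lineW b : line_end u b W = b by rewrite line_endE W1 scale1r.
have Psi_e : Psi Phi_eps = eps by rewrite /Phi_eps PhiK.
have line_e b : lie_comp (line_end u b) Phi_eps = line_end u b.
  by apply: end_eq => k; rewrite eE /lie_comp /= ext_gen lieZ lineW ext_gen.
have Psi_line b : Psi (line_end u b) = const_end (t b).
  apply: end_eq => k; rewrite -[in LHS]line_e PsiM Psi_e /lie_comp /= eps_gen.
  by rewrite ext_gen.
have Phi_const a : Phi (const_end a) = line_end u (s a).
  have <- : lie_comp (const_end a) eps = const_end a.
    by apply: end_eq => k; rewrite /lie_comp /= eps_gen !ext_gen.
  apply: end_eq => k; rewrite PhiM -/Phi_eps eE /lie_comp /= !ext_gen lieZ.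
  by [].
exists s, t; split.
- by move=> a; rewrite /t -Phi_const PhiK ext_gen.
- by move=> b; rewrite /s -Psi_line PsiK lineW.
- move=> nu a; rewrite /s -[RHS]/(lie_comp (Phi nu) (Phi (const_end a)) W) -PhiM.
  by congr (Phi _ W); apply: end_eq => k; rewrite /lie_comp /= !ext_gen.
Qed.

End QuasiInner.

(** * Semi-innerness *)

Lemma rmorphism_of (K : comNzRingType) (f : K -> K) :
  {morph f : a b / a + b} -> {morph f : a b / a * b} -> f 1 = 1 ->
  exists phi : {rmorphism K -> K}, phi =1 f.
Proof.
move=> fD fM f1.
have fB : {morph f : a b / a - b}.
  by move=> a b; apply: (addIr (f b)); rewrite -fD !subrK.
pose add := GRing.isZmodMorphism.Build K K f fB.
pose mul := GRing.isMonoidMorphism.Build K K f (conj f1 fM).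
by exists (HB.pack_for {rmorphism K -> K} f add mul).
Qed.

Section Semilinear.
Variables (K : idomainType) (F : lieAlgType K) (n : nat) (x : 'I_n -> F).
Hypothesis hx : freely_generates x.
Variables i j : 'I_n.
Hypothesis ij : i != j.
Local Notation lincoef := (lincoef hx).

Lemma normalizes_bracket (s t : F -> F) : cancel s t -> cancel t s ->
  normalizes s ->
  exists c, forall a b, t (bracket (s a) (s b)) = c *: bracket a b.
Proof.
move=> st ts s_norm.
have sD a b : s (a + b) = s a + s b := normalizes_add hx ij st ts s_norm a b.
have tD a b : t (a + b) = t a + t b.
  by apply: (can_inj st); rewrite sD !ts.
have tN a : t (- a) = - t a.
  apply: (addIr (t a)); rewrite -tD !addNr.
  by apply: (can_inj st); rewrite ts (normalizes0 hx ts s_norm).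
pose p := t (bracket (s (x i)) (s (x j))).
have pE (a b : F) : sub2 hx i j a b p = t (bracket (s a) (s b)).
  have := @normalizes_op _ _ s t st ts s_norm (@bracket _ F) (sub2 hx i j a b)
    (x i) (x j).
  by move->; rewrite ?sub2l ?sub2r // => f a' b'; rewrite lieBr.
have [c pc] : exists c, p = c *: bracket (x i) (x j).
  apply: (bilinear_alternating (hx := hx) ij).
  - exact: pE.
  - by move=> a a' b; rewrite !pE sD brDl tD.
  - by rewrite pE brC tN.
by exists c => a b; rewrite -pE pc lieZ lieBr sub2l sub2r.
Qed.

Lemma scale_bracket_inj c :
  c *: bracket (x i) (x j) = bracket (x i) (x j) -> c = 1.
Proof.
move/(congr1 (fun u => emb hx u [:: i; j])).
rewrite embZ scalesE embBr !emb_gen addsE oppsE !mul_letter_cons (negPf ij).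
rewrite mul0r subr0 eqxx mul1r /letter eqxx => h.
by rewrite -[c]mulr1; apply: h.
Qed.

Lemma scale_gen_inj c d : c *: x i = d *: x i -> c = d.
Proof.
move/(congr1 (fun u => lincoef u i)).
by rewrite !lincoefZ lincoef_gen eqxx !mulr1.
Qed.

(** The transported bracket is c *: bracket a b, and d is the analogous scalar
    for the inverse of s. Comparing both transports gives d * phi c = 1, and
    d *: s is compatible with brackets; it still induces Phi because every
    endomorphism is linear. *)
Lemma semilinear_adjoint (Phi : {lie F -> F} -> {lie F -> F}) (s t : F -> F) :
  cancel s t -> cancel t s -> normalizes t ->
  (forall (nu : {lie F -> F}) a, s (nu a) = Phi nu (s a)) ->
  exists s' t' : F -> F, [/\ cancel s' t', cancel t' s',
    forall (nu : {lie F -> F}) a, s' (nu a) = Phi nu (s' a) &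
    exists phi : {rmorphism K -> K}, bijective phi /\
      forall (a b : F) (c : K), [/\ s' (a + b) = s' a + s' b,
        s' (bracket a b) = bracket (s' a) (s' b) &
        s' (c *: a) = phi c *: s' a]].
Proof.
move=> st ts t_norm sPhi.
have s_norm : normalizes s by move=> nu; exists (Phi nu).
have sD := normalizes_add hx ij st ts s_norm.
have [psi hpsi] := normalizes_scale hx i st ts s_norm.
have [phi hphi] := normalizes_scale hx i ts st t_norm.
have sZ c a : s (c *: a) = phi c *: s a by rewrite -hphi st.
have tZ c a : t (c *: a) = psi c *: t a by rewrite -hpsi ts.
have phiD c d : phi (c + d) = phi c + phi d.
  by apply: scale_gen_inj; rewrite -hphi scalerDl sD !hphi scalerDl.
have phiM c d : phi (c * d) = phi c * phi d.
  apply: scale_gen_inj; rewrite -hphi -scalerA -[d *: _]st hphi.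
  by rewrite hphi scalerA.
have phi1 : phi 1 = 1.
  by apply: scale_gen_inj; rewrite -hphi !scale1r ts.
have psiK c : phi (psi c) = c.
  by apply: scale_gen_inj; rewrite -hphi -hpsi !ts.
have phiK c : psi (phi c) = c.
  by apply: scale_gen_inj; rewrite -hpsi -hphi !st.
have [c hc] := normalizes_bracket st ts s_norm.
have [d hd] := normalizes_bracket ts st t_norm.
have dc : d * phi c = 1.
  by apply: scale_bracket_inj; rewrite mulrC -scalerA -hd -sZ -hc !ts.
have [rphi rphiE] := rmorphism_of phiD phiM phi1.
exists (fun a => d *: s a), (fun a => t (phi c *: a)); split.
- by move=> a; rewrite scalerA mulrC dc scale1r st.
- by move=> a; rewrite ts scalerA dc scale1r.
- by move=> nu a; rewrite sPhi lieZ.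
exists rphi; split.
  by exists psi => k; rewrite rphiE.
move=> a b k; split.
- by rewrite sD scalerDr.
- have -> : s (bracket a b) = d *: bracket (s a) (s b) by rewrite -hd !st.
  by rewrite brZl brZr.
- by rewrite sZ rphiE !scalerA mulrC.
Qed.
End Semilinear.

(* The rank one case has to be excluded: the free Lie algebra on one generator
   is K x with zero bracket, its endomorphism semigroup is the multiplicative
   monoid of K, and for instance over the rationals the automorphism of that
   monoid exchanging the primes 2 and 3 is not semi-inner. *)
Theorem theoremA (K : idomainType) (hK : R1MF K) (F : lieAlgType K)
  (n : nat) (hn : n <> 1%N) (x : 'I_n -> F) (hx : freely_generates x)
  (Phi : {multiplicative lie_end F -> lie_end F}) (hPhi : bijective Phi) :
  semi_inner Phi.
Proof.
have [Psi PhiK PsiK] := hPhi.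
have PhiM (f g : {lie F -> F}) : (Phi (lie_comp f g) : {lie F -> F}) =
    lie_comp (Phi f : {lie F -> F}) (Phi g : {lie F -> F}).
  exact: (@gmulfM _ _ Phi f g).
suff [s [t [st ts sPhi [phi [phi_bij sphi]]]]] : exists s t : F -> F,
    [/\ cancel s t, cancel t s,
      forall (nu : {lie F -> F}) a, s (nu a) = (Phi nu : {lie F -> F}) (s a) &
      exists phi : {rmorphism K -> K}, bijective phi /\
        forall (a b : F) (c : K), [/\ s (a + b) = s a + s b,
          s (bracket a b) = bracket (s a) (s b) &
          s (c *: a) = phi c *: s a]].
  have adj : adjoint_bijection Phi s.
    by exists t; split=> // nu a; rewrite /= sPhi ts.
  by split; [exists s | exists s; split=> //; exists phi].
case: n hn x hx => [_|[//|n] _] x hx.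
  (* there are no generators, so F = 0 *)
  have F0 (a b : F) : a = b.
    have F0 (a' : F) : a' = 0.
      by elim/(lie_ind hx): a' => [|[]|c a' b' -> ->|a' b' -> _] //;
        rewrite ?scaler0 ?addr0 ?br0l.
    by rewrite (F0 a) (F0 b).
  exists id, id; split=> [//|//|nu a|]; first exact: F0.
  exists idfun; split=> [|a b c]; first by exists id.
  by split; apply: F0.
have [s [t [st ts sPhi]]] := quasi_inner_adjoint hK hx ord0 PhiK PsiK PhiM.
have t_norm : normalizes t.
  by move=> nu; exists (Psi nu) => b; apply: (can_inj st); rewrite ts sPhi PsiK ts.
have ij : ord0 != ord_max :> 'I_n.+2 by [].
exact: (semilinear_adjoint hx ij st ts t_norm sPhi).
Qed.
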